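(* Let $f,g:\mathbb R^d\to\mathbb R$, $\mathcal B=\{x\in\mathbb R^d:\|x\|\le 1\}$ and $\mathcal C=\{x\in\mathbb R^d:g(x)\le 0\}$. Assume: (i) $\mathcal C$ is nonempty, closed and contained in $\mathcal B$, and a point $x_0\in\mathcal C$ is supplied. (ii) On an open convex neighborhood $U$ of $\mathcal B$, $f$ is $\ell$-weakly convex and $G_f$-Lipschitz, with $\ell,G_f>0$. There is a stochastic oracle $\widetilde v(x;\xi)$, queried with fresh randomness $\xi$ at each call, such that for every query point $x$ measurable with respect to the past history $\mathcal F$, $\mathbb E[\widetilde v(x;\xi)\mid\mathcal F]=v(x)\in\partial f(x)$ and $\|\widetilde v(x;\xi)\|\le G_f$ almost surely. (iii) $g$ is convex and continuously differentiable on $U$, and for constants $G_g,\sigma>0$, $\|\nabla g(x)\|\le G_g$ for all $x\in\mathcal B$ and $\|\nabla g(z)\|\ge\sigma$ for all $z\in\mathcal B$ with $g(z)=0$. Values $g(x)$ and gradients $\nabla g(x)$ can be evaluated exactly. (iv) $f$ is differentiable with $\ell$-Lipschitz gradient on $U$. Let $\Delta_f=f(x_0)-\min_{x\in\mathcal B}f(x)$ and let $0<\epsilon\le 1$. Run the Penalized Proximal Subgradient Method with One Projection (described in the context) with penalty $p=p_\gamma$, $p_\gamma(u)=\gamma\log(1+\exp(\lambda_0u/\gamma))$, $\lambda_0=2(G_f+4\ell)/\sigma$, $\gamma=1/K$, $\beta=2\ell$, $m=\ell$, and index set $\mathcal I=\{1,\dots,T\}$. Choose $$T=\max\Big\{2,\Big\lceil\frac{1000\,\ell\Delta_f}{\epsilon^2}\Big\rceil\Big\},$$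 and $K\ge2$ an integer with $e_K(1/(6T))\le e_*$, where $e_K(\cdot)$ and $e_*$ are defined in the context. Then $T=O(1+\ell\Delta_f/\epsilon^2)$, $K$ can be chosen with $K=\widetilde O(\epsilon^{-2})$ for fixed problem parameters, and with these choices the output $\hat x$ satisfies $$\hat x\in\mathcal C,\qquad \Pr\{\mathcal G_\ell(\hat x)\le\epsilon\}\ge\tfrac23,\qquad\text{where }\ \mathcal G_\ell(x)=\ell\,\big\|x-\mathcal P_{\mathcal C}\big(x-\nabla f(x)/\ell\big)\big\|.$$ For fixed problem parameters, the algorithm uses $TK=\widetilde O(\epsilon^{-4})$ stochastic gradient calls and exactly one projection onto $\mathcal C$.
   Context: All norms are Euclidean; $[u]_+=\max\{u,0\}$; $\mathcal P_D(x)=\operatorname{argmin}_{y\in D}\|y-x\|$. $\partial$ denotes the limiting subdifferential. A function is $\ell$-weakly convex if adding $\frac{\ell}{2}\|\cdot\|^2$ makes it convex. $\widetilde O$ hides polylogarithmic factors in $1/\epsilon$; ''fixed problem parameters'' means $\ell,G_f,G_g,\sigma,\Delta_f$ are held fixed. Algorithm (Penalized Proximal Subgradient Method with One Projection). Inputs: $x_0\in\mathcal B$, integers $T,K\ge2$, penalty $p$, index set $\mathcal I$, and $\beta,m>0$ such that each $H_t$ below is $m$-strongly convex on $\mathcal B$. For $t=0,\dots,T-1$: form $H_t(z)=f(z)+p(g(z))+\frac{\beta}{2}\|z-x_t\|^2$ and set $x_{t+1}=\mathrm{PSM}(H_t,x_t)$. Then sample $J$ uniformly from $\mathcal I$ (independently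 of everything else) and return $\hat x\in\mathcal P_{\mathcal C}(x_J)$. Subroutine $\mathrm{PSM}(H_t,x_t)$: set $z_1=x_t$. For $s=1,\dots,K$: set $\eta_s=2/[m(s+1)]$, query $\widetilde v(z_s;\xi_s)$ with fresh $\xi_s$, set $h_s=\widetilde v(z_s;\xi_s)+\beta(z_s-x_t)+\nabla(p\circ g)(z_s)$, and $z_{s+1}=\mathcal P_{\mathcal B}(z_s-\eta_sh_s)$. Return $K^{-1}\sum_{s=1}^Kz_s$. Constants: $G_F=G_f+4\ell$, $G_H=G_F+\lambda_0G_g$, $$U_K(m,G,\delta)=\frac{m+(G^2/m)\{\log(K+1)+2\log(1/\delta)\}}{K},\qquad e_K(\delta)=U_K(\ell,G_H,\delta)+\frac{\log 2}{K},$$ $$e_*=\min\Big\{\frac{\epsilon^2}{4000\,\ell},\ \frac{G_F\epsilon}{60\,\ell}\Big\}.$$ *)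

(* Defs.v *)
From HB Require Import structures.
From mathcomp Require Import all_boot all_order all_algebra.
From mathcomp Require Import all_classical all_reals all_analysis.
Set Implicit Arguments.
Unset Strict Implicit.
Unset Printing Implicit Defensive.
Import Order.TTheory GRing.Theory Num.Theory.
Import numFieldNormedType.Exports.
Local Open Scope classical_set_scope.
Local Open Scope ring_scope.

(* Vectors of R^d are row vectors.  The library norm `|x| on 'rV[R]_d is the
   sup norm, hence the Euclidean norm below; openness, limits, continuity and
   Frechet differentiability do not depend on this choice, so the library
   notions are used for those. *)
Section Euclidean.
Context {R : realType} {d : nat}.
Local Notation V := 'rV[R]_d.
Implicit Types (f h : V -> R) (D : set V) (x y z v : V).

Definition dotp x y : R := \sum_(i < d) x 0 i * y 0 i.
Definition enorm x : R := Num.sqrt (dotp x x).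
Definition unit_ball : set V := [set x | enorm x <= 1].

Definition argmin D h : set V :=
  [set y | D y /\ forall z, D z -> h y <= h z].

(* Meaningful when the minimum is attained, e.g. h continuous and
   D = unit_ball. *)
Definition min_on D h : R := h (xget 0 (argmin D h)).

(* The set P_D(x) of nearest points, and a choice of one of them; for D
   nonempty, closed and convex there is exactly one. *)
Definition projset D x : set V := argmin D (fun y => enorm (y - x)).
Definition nearest D x : V := xget 0 (projset D x).

Definition gradient f x : V := \row_(i < d) 'D_(delta_mx 0 i) f x.

Definition weakly_convex D (l : R) f : Prop :=
  convex_function D (fun x => f x + l / 2 * enorm x ^+ 2).
Definition strongly_convex D (m : R) f : Prop :=
  convex_function D (fun x => f x - m / 2 * enorm x ^+ 2).

Definition frechet_subdiff f x : set V :=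
  [set v | forall e : R, 0 < e ->
     \forall y \near x, f x + dotp v (y - x) - e * enorm (y - x) <= f y].

Definition limiting_subdiff f x : set V :=
  [set v | exists xs vs : nat -> V,
     [/\ forall k, frechet_subdiff f (xs k) (vs k),
         xs @ \oo --> x, f \o xs @ \oo --> f x & vs @ \oo --> v]].

Definition grad_mapping (C : set V) f (l : R) x : R :=
  l * enorm (x - nearest C (x - l^-1 *: gradient f x)).

End Euclidean.

(* Programs that may query a stochastic gradient oracle and project onto a
   set C.  These are the only two means of access to the oracle and to C. *)
Section Programs.
Context {R : realType} {d : nat}.
Local Notation V := 'rV[R]_d.

Inductive prog : Type :=
| Return of V
| Query of V & (V -> prog)
| Project of V & (V -> prog).

(* [exec ans C pr n c (y, n', c')]: started after n oracle calls and c
   projections, pr may return y after n' calls and c' projections in total.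
   The n-th call, at z, is answered by ans n z, so that every call consumes a
   fresh sample.  The result is a relation because P_C is set-valued. *)
Fixpoint exec (ans : nat -> V -> V) (C : set V) (pr : prog) (n c : nat)
    : set (V * nat * nat) :=
  match pr with
  | Return y => [set (y, n, c)]
  | Query z k => exec ans C (k (ans n z)) n.+1 c
  | Project x k => \bigcup_(y in projset C x) exec ans C (k y) n c.+1
  end.

Variables (f g : V -> R) (p : R -> R) (beta m : R) (T K : nat).

Definition subproblem (c : V) (z : V) : R :=
  f z + p (g z) + beta / 2 * enorm (z - c) ^+ 2.

(* PSM with centre x: the iterations s, ..., s + r - 1 from z_s = z, with
   acc = z_1 + ... + z_(s-1); the average is then passed to k. *)
Fixpoint psm_loop (x : V) (r s : nat) (z acc : V) (k : V -> prog) : prog :=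
  if r isn't r'.+1 then k (K%:R^-1 *: acc) else
  Query z (fun v =>
    let h := v + beta *: (z - x) + gradient (p \o g) z in
    psm_loop x r' s.+1
      (nearest unit_ball (z - (2 / (m * s.+1%:R)) *: h)) (acc + z) k).

Definition psm (x : V) (k : V -> prog) : prog := psm_loop x K 1 x 0 k.

(* xs lists the outer iterates x_0, ..., x already computed. *)
Fixpoint outer_loop (r : nat) (xs : seq V) (x : V) (k : seq V -> prog) : prog :=
  if r isn't r'.+1 then k xs else
  psm x (fun y => outer_loop r' (rcons xs y) y k).

(* The sampled index J is an argument. *)
Definition penalized_psm (x0 : V) (J : nat) : prog :=
  outer_loop T [:: x0] x0 (fun xs => Project (nth 0 xs J) Return).

End Programs.

Section Randomness.
Context {R : realType} {dO : measure_display} {Omega : measurableType dO}.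
Variable P : probability Omega R.

(* The sigma-algebra generated by xi 0, ..., xi (k-1). *)
Definition history {dX : measure_display} {Xi : measurableType dX}
    (xi : nat -> Omega -> Xi) (k : nat) : set (set Omega) :=
  g_sigma_preimage (fun i : 'I_k => xi i).

(* Y is a version of E[X | F]. *)
Definition is_cond_exp (F : set (set Omega)) (X Y : Omega -> R) : Prop :=
  [/\ P.-integrable setT (EFin \o X), P.-integrable setT (EFin \o Y),
      forall S : set R, measurable S -> F (Y @^-1` S) &
      forall A, F A ->
        (\int[P]_(w in A) (X w)%:E = \int[P]_(w in A) (Y w)%:E)%E].

(* The k-th call at z returns vt z (xi k).  Random query points X take values
   in B, the only place where the oracle is ever queried; joint measurability
   makes vt (X w) (xi k w) a random vector. *)
Definition stochastic_oracle {dX : measure_display} {Xi : measurableType dX}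
    {d : nat} (xi : nat -> Omega -> Xi) (B : set 'rV[R]_d)
    (v : 'rV[R]_d -> 'rV[R]_d) (G : R) (vt : 'rV[R]_d -> Xi -> 'rV[R]_d)
    : Prop :=
  [/\ forall k, measurable_fun setT (xi k),
      forall i : 'I_d,
        @measurable_fun _ _ (g_sigma_algebraType (@open 'rV[R]_d) * Xi)%type R
          (B `*` setT) (fun q => vt q.1 q.2 0 i) &
      forall (k : nat) (X : Omega -> 'rV[R]_d),
        (forall w, B (X w)) ->
        (forall S : set 'rV[R]_d, open S -> history xi k (X @^-1` S)) ->
        {ae P, forall w, enorm (vt (X w) (xi k w)) <= G} /\
        forall i : 'I_d, is_cond_exp (history xi k)
          (fun w => vt (X w) (xi k w) 0 i) (fun w => v (X w) 0 i)].

(* J is uniform on the (duplicate-free) index list I and independent of all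
   the oracle's randomness. *)
Definition uniform_index {dX : measure_display} {Xi : measurableType dX}
    (xi : nat -> Omega -> Xi) (I : seq nat) (J : Omega -> nat) : Prop :=
  [/\ measurable_fun setT J,
      forall j, P (J @^-1` [set j]) = ((j \in I)%:R / (size I)%:R)%:E &
      forall (k : nat) (A : set Omega) (S : set nat), history xi k A ->
        P (J @^-1` S `&` A) = (P (J @^-1` S) * P A)%E].

End Randomness.

Section Constants.
Context {R : realType}.
Implicit Types l Gf Gg sigma Delta eps delta gam lam : R.

Definition lambda0 l Gf sigma : R := 2 * (Gf + 4 * l) / sigma.
Definition GF l Gf : R := Gf + 4 * l.
Definition GH l Gf Gg sigma : R := GF l Gf + lambda0 l Gf sigma * Gg.

Definition softplus lam gam (u : R) : R :=
  gam * ln (1 + expR (lam * u / gam)).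

Definition U_ (K : nat) (m G delta : R) : R :=
  (m + G ^+ 2 / m * (ln (K.+1%:R) + 2 * ln (delta^-1))) / K%:R.
Definition e_ (K : nat) l Gf Gg sigma delta : R :=
  U_ K l (GH l Gf Gg sigma) delta + ln 2 / K%:R.
Definition e_star l Gf eps : R :=
  Num.min (eps ^+ 2 / (4000 * l)) (GF l Gf * eps / (60 * l)).

(* Only used with l * Delta >= 0, where the absolute value is harmless. *)
Definition horizon l Delta eps : nat :=
  maxn 2 `|Num.ceil (1000 * l * Delta / eps ^+ 2)|%N.

Definition admissible_K l Gf Gg sigma Delta eps (K : nat) : Prop :=
  (2 <= K)%N /\
  e_ K l Gf Gg sigma ((6 * (horizon l Delta eps)%:R)^-1) <= e_star l Gf eps.

(* F(eps) = O~(eps^-q), with a bound valid on the whole range 0 < eps <= 1;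
   1 + log(1/eps) rather than log(1/eps) because the latter vanishes at 1. *)
Definition soft_O (F : R -> R) (q : nat) : Prop :=
  exists (c : R) (a : nat), forall eps, 0 < eps <= 1 ->
    F eps <= c * eps ^- q * (1 + ln (eps^-1)) ^+ a.

End Constants.

(* Main.v *)
Require Import Defs.
From HB Require Import structures.
From mathcomp Require Import all_boot all_order all_algebra.
From mathcomp Require Import all_classical all_reals all_analysis.
From mathcomp Require Import measurable_realfun ring lra.
Import Order.TTheory GRing.Theory Num.Theory.
Import numFieldNormedType.Exports.
Local Open Scope classical_set_scope.
Local Open Scope ring_scope.

(** The theorem combines a deterministic analysis of an inexact proximal point method
with a high-probability bound for each of its inner runs.

Exact penalization. The gradient of the constraint [g] is at least [sigma] on the
boundary of the feasible set C, and the normal cone at a boundary point is spanned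
by it, so the positive part of [g] grows at rate [sigma] away from C
([feasible_error_bound]). The prox objective [f + l |. - x|^2] is [GF]-Lipschitz on
the ball and the penalty has slope [lambda0 = 2 GF / sigma], so the penalized objective
over the ball and the prox objective over C have the same minimizer [prox x]
([prox_penalized]). The softplus differs from the exact penalty by at most [ln 2 / K].

One inner run. The projected subgradient method with steps [2 / (l (s + 1))] on an
[l]-strongly convex objective has a telescoping regret. The telescoping leaves a
negative surplus, [- l / 4] times the squared distance to the comparison point in each
round ([psm_regret]), and the noise of the oracle is a martingale whose conditional
exponential moments are controlled by the same squared distances
([expR_noise_le]). The exponential of the scaled noise minus surplus is therefore a
supermartingale ([exp_supermartingale]), and Markov's inequality gives the
logarithmic dependence on the failure probability ([total_noise_tail]). On the
complementary event the average of the run minimizes the penalized objective up to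
[e_K] ([psm_certificate]). As the oracle is bounded only almost surely, the
supermartingale is built with truncated answers.

The outer loop. An inexact minimizer [z] of the penalized objective centred at [x] is
close to [prox x] by strong convexity, and the merit function [f + lambda0 [g]_+]
drops by [l / 2 |x - prox x|^2] ([merit_descent]). The point [prox x] is itself the
projection of a gradient step perturbed by [2 (prox x - x)], so the gradient mapping at
[prox x] is at most [2 l |prox x - x|], and the gradient mapping at the projection of [z]
is controlled by the distances of [z] and [x] to [prox x] ([grad_mapping_nearest]).
A step with a non-stationary result thus costs a fixed amount of merit, and
the choice of T leaves at least 4/5 of the iterates stationary
([most_iterates_stationary]).

Probability. Each run fails with probability at most 1 / (6 T), so all of them succeed
with probability at least 5/6; the index J is independent of the oracle's samples and
uniform, so it then selects a stationary iterate with probability at least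
5/6 * 4/5 = 2/3 ([stationary_output_prob]).

Complexity. [e_K] is of order [(ln K + ln T) / K], and it has to be at most a multiple of
[eps ^ 2] ([e_star_ge]); as T is polynomial in [1 / eps], a K of order [1 / eps ^ 2]
times [1 + ln (1 / eps)] suffices ([admissible_K_exists]). *)

Set Implicit Arguments.
Unset Strict Implicit.
Unset Printing Implicit Defensive.

(** * Euclidean space *)

Section Euclid.
Context {R : realType} {d : nat}.
Local Notation V := 'rV[R]_d.
Implicit Types (x y z u : V) (a e : R) (D : set V) (h : V -> R).

Lemma dotpC x y : dotp x y = dotp y x.
Proof. by apply: eq_bigr => i _; rewrite mulrC. Qed.

Lemma dotpDl x y z : dotp (x + y) z = dotp x z + dotp y z.
Proof. by rewrite -big_split; apply: eq_bigr => i _; rewrite mxE mulrDl. Qed.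

Lemma dotpZl a x y : dotp (a *: x) y = a * dotp x y.
Proof. by rewrite /dotp mulr_sumr; apply: eq_bigr => i _; rewrite mxE mulrA. Qed.

Lemma dotpNl x y : dotp (- x) y = - dotp x y.
Proof. by rewrite -scaleN1r dotpZl mulN1r. Qed.

Lemma dotpDr x y z : dotp z (x + y) = dotp z x + dotp z y.
Proof. by rewrite dotpC dotpDl !(dotpC z). Qed.

Lemma dotpZr a x y : dotp x (a *: y) = a * dotp x y.
Proof. by rewrite dotpC dotpZl dotpC. Qed.

Lemma dotpNr x y : dotp x (- y) = - dotp x y.
Proof. by rewrite dotpC dotpNl dotpC. Qed.

Definition dotpE := (dotpDl, dotpDr, dotpNl, dotpNr, dotpZl, dotpZr).

Lemma dotp_ge0 x : 0 <= dotp x x.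
Proof. by apply: sumr_ge0 => i _; rewrite -expr2 sqr_ge0. Qed.

Lemma enorm_ge0 x : 0 <= enorm x.
Proof. exact: sqrtr_ge0. Qed.

Lemma enorm2E x : enorm x ^+ 2 = dotp x x.
Proof. by rewrite sqr_sqrtr// dotp_ge0. Qed.

Lemma enormZ a x : enorm (a *: x) = `|a| * enorm x.
Proof.
by rewrite /enorm dotpZl dotpZr mulrA -expr2 sqrtrM ?sqr_ge0// sqrtr_sqr.
Qed.

Lemma enormN x : enorm (- x) = enorm x.
Proof. by rewrite -scaleN1r enormZ normrN1 mul1r. Qed.

Lemma enorm0 : enorm (0 : V) = 0.
Proof. by rewrite -(scale0r (0 : V)) enormZ normr0 mul0r. Qed.

Lemma enormBC x y : enorm (x - y) = enorm (y - x).
Proof. by rewrite -opprB enormN. Qed.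

Lemma coord_le_enorm x i : `|x 0 i| <= enorm x.
Proof.
rewrite -sqrtr_sqr ler_wsqrtr// expr2 /dotp (bigD1 i)//= lerDl.
by apply: sumr_ge0 => j _; rewrite -expr2 sqr_ge0.
Qed.

Lemma enorm_eq0 x : enorm x = 0 -> x = 0.
Proof.
move=> x0; apply/rowP => i; rewrite mxE; apply/eqP.
by rewrite -normr_le0 -x0 coord_le_enorm.
Qed.

Lemma dotp0l x : dotp 0 x = 0.
Proof. by rewrite -(scale0r 0) dotpZl mul0r. Qed.

Lemma dotp0r x : dotp x 0 = 0.
Proof. by rewrite dotpC dotp0l. Qed.

Lemma dotp_le x y : dotp x y <= enorm x * enorm y.
Proof.
have [/enorm_eq0 ->|x0] := eqVneq (enorm x) 0; first by rewrite dotp0l enorm0 mul0r.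
have [/enorm_eq0 ->|y0] := eqVneq (enorm y) 0; first by rewrite dotp0r enorm0 mulr0.
have xp : 0 < enorm x by rewrite lt_def x0 enorm_ge0.
have yp : 0 < enorm y by rewrite lt_def y0 enorm_ge0.
have := dotp_ge0 (enorm y *: x - enorm x *: y).
rewrite !dotpE (dotpC y x) -!enorm2E.
have : 0 < enorm x * enorm y by rewrite mulr_gt0.
move: (enorm x) (enorm y) (dotp x y) => a b c ab H.
suff : 0 <= 2 * (a * b) * (a * b - c) by rewrite pmulr_rge0 ?subr_ge0// mulr_gt0.
by move: H; lra.
Qed.

Lemma normr_dotp_le x y : `|dotp x y| <= enorm x * enorm y.
Proof.
by rewrite ler_norml dotp_le andbT lerNl -dotpNl -(enormN x) dotp_le.
Qed.

Lemma enorm_le_sqr x e : 0 <= e -> (enorm x <= e) = (dotp x x <= e ^+ 2).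
Proof. by move=> e0; rewrite -enorm2E ler_sqr ?nnegrE ?enorm_ge0. Qed.

Lemma enormD x y : enorm (x + y) <= enorm x + enorm y.
Proof.
rewrite enorm_le_sqr ?addr_ge0 ?enorm_ge0// !dotpE sqrrD !enorm2E (dotpC y x).
have := dotp_le x y; lra.
Qed.

Lemma enormB x y : enorm (x - y) <= enorm x + enorm y.
Proof. by rewrite -(enormN y) enormD. Qed.

Lemma enorm_triangle z x y : enorm (x - y) <= enorm (x - z) + enorm (z - y).
Proof. by rewrite (_ : x - y = (x - z) + (z - y)) ?enormD// addrA subrK. Qed.

Lemma enorm_sum (I : Type) (r : seq I) (F : I -> V) :
  enorm (\sum_(i <- r) F i) <= \sum_(i <- r) enorm (F i).
Proof.
elim/big_rec2: _ => [|i y x _ IH]; first by rewrite enorm0.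
by rewrite (le_trans (enormD _ _))// lerD2l.
Qed.

(** The topology and the norm of row vectors are those of the sup norm; openness,
limits and compactness are transferred through this comparison. *)
Lemma normr_le_enorm x : `|x| <= enorm x.
Proof.
rewrite [leLHS]/Num.norm /= mx_normrE; apply/bigmax_leP; split; first exact: enorm_ge0.
by case=> i j _ /=; rewrite (ord1 i) coord_le_enorm.
Qed.

Lemma coord_le_normr x i : `|x 0 i| <= `|x|.
Proof.
by rewrite [leRHS]/Num.norm /= mx_normrE; apply/bigmax_geP; right; exists (0, i).
Qed.

Lemma enorm_le_normr x : enorm x <= d.+1%:R * `|x|.
Proof.
rewrite enorm_le_sqr ?mulr_ge0//.
have : dotp x x <= \sum_(i < d) `|x| ^+ 2.
  apply: ler_sum => i _; rewrite -expr2 -real_normK ?num_real//.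
  by rewrite ler_sqr ?nnegrE// coord_le_normr.
move=> /le_trans; apply; rewrite sumr_const card_ord exprMn -[leLHS]mulr_natl.
rewrite ler_wpM2r ?sqr_ge0// -natrX ler_nat.
by rewrite (leq_trans (leqnSn d))// -mulnn leq_pmulr.
Qed.

Lemma enorm_nbhsP x (A : set V) :
  nbhs x A <-> exists2 e, 0 < e & forall y, enorm (y - x) < e -> A y.
Proof.
split=> [/nbhs_normP[e /= e0 H]|[e e0 H]].
  exists e => // y yx; apply: H => /=.
  by rewrite -normrN opprB (le_lt_trans (normr_le_enorm _)).
apply/(nbhs_normP x A); exists (e / d.+1%:R) => /=; first by rewrite divr_gt0.
move=> y /= yx; apply: H; rewrite (le_lt_trans (enorm_le_normr _))//.
by rewrite -ltr_pdivlMl// mulrC -normrN opprB.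
Qed.

Lemma enorm_cvgP (T : Type) (F : set_system T) (FF : Filter F) (X : T -> V) x :
  (X @ F --> x) <-> forall e, 0 < e -> \forall t \near F, enorm (X t - x) < e.
Proof.
split=> [H e e0|H].
  by apply: (H [set y | enorm (y - x) < e]); apply/enorm_nbhsP; exists e.
move=> A /enorm_nbhsP[e e0 He].
by have := H _ e0; apply: filterS => t /He.
Qed.

Lemma enorm_small x (L e : R) : 0 < e ->
  nbhs x [set y | `|L| * enorm (y - x) < e].
Proof.
move=> e0; apply/enorm_nbhsP; exists (e / (`|L| + 1)) => [|y /= yx].
  by rewrite divr_gt0// ltr_wpDl.
rewrite ltr_pdivlMr ?ltr_wpDl// in yx; apply: le_lt_trans yx.
by rewrite mulrC ler_wpM2l ?enorm_ge0// lerDl.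
Qed.

Lemma lip_continuous (h : V -> R) (L : R) x :
  (forall y, `|h y - h x| <= L * enorm (y - x)) -> {for x, continuous h}.
Proof.
move=> H; apply/(@cvgrPdist_lt _ _ _ (nbhs x) (nbhs_filter x)) => e e0.
apply: (filterS _ (enorm_small x L e0)) => y /=; rewrite distrC.
apply: le_lt_trans; apply: le_trans (H y) _.
by rewrite ler_wpM2r ?enorm_ge0// ler_norm.
Qed.

Lemma lip_continuousV (h : V -> V) (L : R) x :
  (forall y, enorm (h y - h x) <= L * enorm (y - x)) -> {for x, continuous h}.
Proof.
move=> H; apply/(@enorm_cvgP _ (nbhs x) (nbhs_filter x)) => e e0.
apply: (filterS _ (enorm_small x L e0)) => y /=.
apply: le_lt_trans; apply: le_trans (H y) _.
by rewrite ler_wpM2r ?enorm_ge0// ler_norm.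
Qed.

Lemma enorm_continuous : continuous (enorm : V -> R).
Proof.
move=> x; apply: (@lip_continuous _ 1) => y.
rewrite mul1r ler_norml; apply/andP; split.
  have := enorm_triangle y x 0; rewrite !subr0 (enormBC x); lra.
have := enorm_triangle x y 0; rewrite !subr0; lra.
Qed.

Lemma coord_continuousV i : continuous (fun x : V => x 0 i).
Proof.
move=> x; apply: (@lip_continuous _ 1) => y.
by have := coord_le_enorm (y - x) i; rewrite !mxE mul1r.
Qed.

Lemma closed_unit_ball : closed (unit_ball : set V).
Proof.
have -> : unit_ball = enorm @^-1` [set t : R | t <= 1] :> set V by [].
by apply: preimage_closed; [move=> x _; exact: enorm_continuous|exact: closed_le].
Qed.

Lemma compact_sub_unit_ball D : closed D -> D `<=` unit_ball -> compact D.
Proof.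
move=> cD DB; apply: bounded_closed_compact => //.
exists 1; split=> // M M1 x Dx; apply: le_trans (normr_le_enorm _) _.
exact: le_trans (DB _ Dx) (ltW M1).
Qed.

(** ** Convexity in elementary terms *)

Lemma convex_setP D :
  convex_set D <->
  forall x y t, D x -> D y -> 0 <= t <= 1 -> D (t *: x + (1 - t) *: y).
Proof.
split=> [H x y t Dx Dy t01|H x y t].
  have := H x y (Itv01 (proj1 (andP t01)) (proj2 (andP t01))) (mem_set Dx) (mem_set Dy).
  by rewrite inE.
rewrite !inE => Dx Dy; apply: H => //.
by apply/andP; split; [exact: ge0|exact: le1].
Qed.

Lemma convex_functionP D h :
  convex_function D h <->
  forall x y t, D x -> D y -> 0 <= t <= 1 ->
    h (t *: x + (1 - t) *: y) <= t * h x + (1 - t) * h y.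
Proof.
split=> [H x y t Dx Dy t01|H t x y].
  exact: (H (Itv01 (proj1 (andP t01)) (proj2 (andP t01))) x y (mem_set Dx) (mem_set Dy)).
rewrite !inE => Dx Dy; apply: H => //.
by apply/andP; split; [exact: ge0|exact: le1].
Qed.

Lemma enorm_conv x y t : 0 <= t <= 1 ->
  enorm (t *: x + (1 - t) *: y) <= t * enorm x + (1 - t) * enorm y.
Proof.
move=> /andP[t0 t1]; apply: le_trans (enormD _ _) _.
by rewrite !enormZ !ger0_norm ?subr_ge0.
Qed.

Lemma convex_unit_ball : convex_set (unit_ball : set V).
Proof.
apply/convex_setP => x y t; rewrite /unit_ball /= => x1 y1 t01.
apply: le_trans (enorm_conv _ _ t01) _; case/andP: t01 => t0 t1; nra.
Qed.

Lemma unit_ball0 : unit_ball (0 : V).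
Proof. by rewrite /unit_ball /= enorm0. Qed.

Lemma enormB_unit_ball x y : unit_ball x -> unit_ball y -> enorm (x - y) <= 2.
Proof.
by rewrite /unit_ball /= => x1 y1; apply: le_trans (enormB _ _) _; lra.
Qed.

End Euclid.

(** * Minimizers and projections over convex sets *)

Section Minimizers.
Context {R : realType} {d : nat}.
Local Notation V := 'rV[R]_d.
Implicit Types (x y z u : V) (D : set V) (h : V -> R).

(** The limit [t -> 0] in all the variational arguments: what a small step of length
[t] proves up to an error of order [t] holds exactly. *)
Lemma le0_small (r a b : R) : 0 < r ->
  (forall t, 0 < t < r -> a <= t * b) -> a <= 0.
Proof.
move=> r0 H; rewrite leNgt; apply/negP => a0.
have b0 : 0 < `|b| + 1 by rewrite ltr_wpDl.
pose t := Num.min (r / 2) (a / (2 * (`|b| + 1))).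
have t0 : 0 < t by rewrite lt_min !divr_gt0// mulr_gt0.
have tr : t < r.
  by apply: (@le_lt_trans _ _ (r / 2)); [rewrite ge_min lexx|lra].
have ta : t * (`|b| + 1) <= a / 2.
  rewrite -ler_pdivlMr// -mulrA -invfM; apply: (@le_trans _ _ (a / (2 * (`|b| + 1)))) => //.
  by rewrite ge_min lexx orbT.
have := H t; rewrite t0 tr => /(_ isT); have := ler_norm b; nra.
Qed.

Lemma argmin_nonempty D h (L : R) : closed D -> D `<=` unit_ball -> D !=set0 ->
  (forall x y, D x -> D y -> `|h x - h y| <= L * enorm (x - y)) ->
  argmin D h !=set0.
Proof.
move=> cD DB D0 hL.
have hc : {within D, continuous h}.
  apply/subspace_continuousP => x Dx.
  apply/(@cvgrPdist_lt _ _ _ (within D (nbhs x)) (within_filter _ (nbhs_filter x))) => e e0.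
  apply: (filterS _ (enorm_small x L e0)) => y /= xy Dy.
  rewrite distrC; apply: le_lt_trans xy; apply: le_trans (hL _ _ Dy Dx) _.
  by rewrite ler_wpM2r ?enorm_ge0// ler_norm.
have [c Dc hmin] := EVT_min_rV D0 (compact_sub_unit_ball cD DB) hc.
by exists c; split=> [|z Dz]; [exact: set_mem|apply: hmin; rewrite inE].
Qed.

Lemma xget_argmin D h : argmin D h !=set0 -> argmin D h (xget 0 (argmin D h)).
Proof. exact: xgetPex. Qed.

(** Compare the minimizer with the points of the segment towards [z] and let
them tend to it. *)
Lemma strong_growth D h (m : R) y z : convex_set D -> strongly_convex D m h ->
  argmin D h y -> D z -> h y + m / 2 * enorm (z - y) ^+ 2 <= h z.
Proof.
move=> /convex_setP cD /convex_functionP sc [Dy ymin] Dz.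
rewrite -subr_le0; apply: (@le0_small 1 _ (m / 2 * enorm (z - y) ^+ 2)) => // t /andP[t0 t1].
have t01 : 0 <= t <= 1 by rewrite !ltW.
have := ymin _ (cD _ _ _ Dz Dy t01).
have := sc _ _ _ Dz Dy t01.
rewrite !enorm2E !dotpE (dotpC y z).
move: (dotp z z) (dotp y y) (dotp z y) (h _) (h z) (h y) => a b c p q r.
move=> H1 H2; rewrite -(ler_pM2l t0); nra.
Qed.

End Minimizers.

Section Projection.
Context {R : realType} {d : nat}.
Local Notation V := 'rV[R]_d.
Implicit Types (x y z u : V).
Variable D : set V.
Hypotheses (cD : closed D) (DB : D `<=` unit_ball) (D0 : D !=set0) (xD : convex_set D).

Lemma nearestP x : projset D x (nearest D x).
Proof.
apply: xget_argmin; apply: (@argmin_nonempty _ _ _ _ 1) => // y z _ _; rewrite mul1r.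
have := enorm_triangle z y x; have := enorm_triangle y z x; rewrite (enormBC z y).
by rewrite ler_norml => *; apply/andP; split; lra.
Qed.

Lemma nearest_in x : D (nearest D x).
Proof. by have [] := nearestP x. Qed.

(** The obtuse angle at a projection: a small step from [y] towards [z] stays in [D]
and cannot come closer to [x]. *)
Lemma projset_var x y z : projset D x y -> D z -> dotp (x - y) (z - y) <= 0.
Proof.
move=> [Dy ymin] Dz.
apply: (@le0_small _ 1 _ (dotp (z - y) (z - y) / 2)) => // t /andP[t0 t1].
have Dt : D (t *: z + (1 - t) *: y).
  by move/convex_setP: xD; apply => //; rewrite !ltW.
have := ymin _ Dt; rewrite enorm_le_sqr ?enorm_ge0// enorm2E.
rewrite !dotpE (dotpC y z) (dotpC y x) (dotpC z x).
move: (dotp z z) (dotp y y) (dotp z y) (dotp x x) (dotp x y) (dotp x z) => a b c p q r.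
by move=> H; rewrite -(ler_pM2l t0); nra.
Qed.

Lemma var_projset x y z :
  D y -> (forall u, D u -> dotp (x - y) (u - y) <= 0) -> D z ->
  enorm (x - y) ^+ 2 + enorm (z - y) ^+ 2 <= enorm (x - z) ^+ 2.
Proof.
move=> Dy H Dz; have := H _ Dz; rewrite !enorm2E !dotpE.
rewrite (dotpC y z) (dotpC y x) (dotpC z x); lra.
Qed.

Lemma projset_unique x y z : D y -> (forall u, D u -> dotp (x - y) (u - y) <= 0) ->
  projset D x z -> z = y.
Proof.
move=> Dy H [Dz zmin]; have := var_projset Dy H Dz; have := zmin _ Dy.
rewrite -ler_sqr ?nnegrE ?enorm_ge0// (enormBC z x) (enormBC y x) => H1 H2.
have : enorm (z - y) ^+ 2 <= 0 by lra.
rewrite exprn_even_le0//= => /eqP/enorm_eq0/eqP; by rewrite subr_eq0 => /eqP.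
Qed.

Lemma nearest_eq x y : D y -> (forall u, D u -> dotp (x - y) (u - y) <= 0) ->
  nearest D x = y.
Proof. by move=> Dy H; apply: projset_unique (nearestP x). Qed.

Lemma projset_nearest x y : projset D x y -> y = nearest D x.
Proof. by move=> py; apply/esym/nearest_eq; [case: py|move=> u; exact: projset_var]. Qed.

Lemma nearest_id x : D x -> nearest D x = x.
Proof. by move=> Dx; apply: nearest_eq => // u _; rewrite subrr dotp0l. Qed.

(** Add the two obtuse angle inequalities at the projections of [x] and [y]. *)
Lemma nearest_lip x y : enorm (nearest D x - nearest D y) <= enorm (x - y).
Proof.
have := projset_var (nearestP x) (nearest_in y).
have := projset_var (nearestP y) (nearest_in x).
move: (nearest D x) (nearest D y) => p q H1 H2.
have H : dotp (p - q) (p - q) <= dotp (x - y) (p - q).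
  move: H1 H2; rewrite !dotpE (dotpC q p); lra.
have [->|n0] := eqVneq (enorm (p - q)) 0; first exact: enorm_ge0.
have n1 : 0 < enorm (p - q) by rewrite lt_def n0 enorm_ge0.
rewrite -(ler_pM2r n1) -expr2 enorm2E; exact: le_trans H (dotp_le _ _).
Qed.

Lemma nearest_continuous : continuous (nearest D).
Proof.
by move=> x; apply: (@lip_continuousV _ _ _ 1) => y; rewrite mul1r nearest_lip.
Qed.

End Projection.

(** * Derivatives, subgradients and the smoothed penalty *)

Section Calculus.
Context {R : realType} {d : nat}.
Local Notation V := 'rV[R]_d.
Implicit Types (x y z u v : V) (D U : set V) (h f : V -> R) (e t : R).

Lemma derive_gradient h x u : differentiable h x -> 'D_u h x = dotp (gradient h x) u.
Proof.
move=> dh; rewrite deriveE// [u in LHS]row_sum_delta linear_sum.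
by apply: eq_bigr => i _; rewrite linearZ /= mulrC mxE deriveE.
Qed.

Lemma directional_expansion h x u e : differentiable h x -> 0 < e ->
  exists2 dlt, 0 < dlt & forall t, 0 < t < dlt ->
    `|h (x + t *: u) - h x - t * dotp (gradient h x) u| <= e * t.
Proof.
move=> dh e0.
have /cvgrPdist_le/(_ _ e0) : t^-1 *: ((h \o shift x) (t *: u) - h x) @[t --> 0^'] --> 'D_u h x.
  exact: (@diff_derivable R _ _ h x u dh).
move=> /nbhs_normP[r /= r0 Hr]; exists r => // t /andP[t0 tr].
have := Hr t; rewrite /= sub0r normrN gtr0_norm// => /(_ tr); rewrite gt_eqF// => /(_ isT).
rewrite derive_gradient// -(ler_pM2l t0) -{1}(gtr0_norm t0) -normrM mulrBr.
rewrite /GRing.scale /= mulVKf ?gt_eqF// (addrC _ x).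
by rewrite distrC (mulrC e).
Qed.

(** The part of the subgradient property that convexity arguments use. Both
Frechet subgradients and gradients have it, which lets one global inequality
serve for the oracle's mean and for the gradient of the constraint. *)
Definition ray_subgradient h x v u :=
  forall e, 0 < e -> exists2 dlt, 0 < dlt &
    forall t, 0 < t < dlt -> h x + t * dotp v u - e * t <= h (x + t *: u).

Lemma frechet_ray h x v u : frechet_subdiff h x v -> ray_subgradient h x v u.
Proof.
move=> H e e0.
have e1 : 0 < e / (enorm u + 1) by rewrite divr_gt0// ltr_wpDl ?enorm_ge0.
have /enorm_nbhsP[r r0 Hr] := H _ e1.
exists (r / (enorm u + 1)) => [|t /andP[t0 tr]].
  by rewrite divr_gt0// ltr_wpDl ?enorm_ge0.
rewrite ltr_pdivlMr ?ltr_wpDl ?enorm_ge0// in tr.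
have xy : x + t *: u - x = t *: u by rewrite addrC addKr.
have := Hr (x + t *: u); rewrite xy enormZ gtr0_norm// dotpZr.
have tu : t * enorm u < r.
  by apply: le_lt_trans tr; rewrite ler_wpM2l ?(ltW t0)// lerDl.
move=> /(_ tu); apply: le_trans.
rewrite lerD2l lerN2 mulrCA [leRHS]mulrC ler_wpM2l ?(ltW t0)//.
by rewrite mulrAC ler_pdivrMr ?ltr_wpDl ?enorm_ge0// ler_wpM2l ?(ltW e0)// lerDl.
Qed.

Lemma gradient_ray h x u : differentiable h x -> ray_subgradient h x (gradient h x) u.
Proof.
move=> dh e e0; have [r r0 Hr] := directional_expansion u dh e0.
exists r => // t tr; have := Hr t tr; rewrite ler_norml => /andP[H _]; lra.
Qed.

(** Weak convexity turns a subgradient inequality on a ray near [x] into a global one: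
compare [f] at the points [x + t (u - x)] for small [t]. *)
Lemma weakly_convex_ray U (l : R) f x v u : convex_set U -> weakly_convex U l f ->
  U x -> U u -> ray_subgradient f x v (u - x) ->
  f x + dotp v (u - x) - l / 2 * enorm (u - x) ^+ 2 <= f u.
Proof.
move=> /convex_setP cU /convex_functionP wf Ux Uu H.
rewrite -subr_le0; set a := (X in X <= 0).
suff key e : 0 < e -> a <= e.
  by apply: (@le0_small _ 1 _ 1) => // t /andP[t0 _]; rewrite mulr1 key.
move=> e0; rewrite -subr_le0; have [r r0 Hr] := H _ e0.
apply: (@le0_small _ (Num.min r 1) _ (- (l / 2 * enorm (u - x) ^+ 2))).
  by rewrite lt_min r0 ltr01.
move=> t /andP[t0]; rewrite lt_min => /andP[tr t1].
have t01 : 0 <= t <= 1 by rewrite !ltW.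
have H2 := wf _ _ _ Uu Ux t01; have := Hr t; rewrite t0 tr => /(_ isT).
have -> : x + t *: (u - x) = t *: u + (1 - t) *: x.
  by rewrite scalerBr scalerBl scale1r addrCA addrA.
move=> H1; rewrite /a -(ler_pM2l t0); move: H1 H2.
rewrite !enorm2E !dotpE (dotpC x u); lra.
Qed.

(** Passing to the limit, limiting subgradients of a weakly convex function satisfy
the same global inequality as Frechet ones. *)
Lemma weakly_convex_limiting U (l : R) f x v u : open U -> convex_set U ->
  weakly_convex U l f -> U x -> U u -> limiting_subdiff f x v ->
  f x + dotp v (u - x) - l / 2 * enorm (u - x) ^+ 2 <= f u.
Proof.
move=> oU cU wf Ux Uu [xs [vs [Hsub xsx fxs vsv]]].
have coord (ys : nat -> V) y i : ys @ \oo --> y -> (fun k => ys k 0 i) @ \oo --> y 0 i.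
  move=> yy; apply: (@cvg_comp _ _ _ ys (fun z : V => z 0 i) \oo (nbhs y) _ yy).
  exact: coord_continuousV.
have cux : (fun k => u - xs k) @ \oo --> u - x by apply: cvgB => //; exact: cvg_cst.
have cdot (ys zs : nat -> V) y z : ys @ \oo --> y -> zs @ \oo --> z ->
    (fun k => dotp (ys k) (zs k)) @ \oo --> dotp y z.
  move=> yy zz; apply: cvg_big => [|i _]; first exact: add_continuous.
  by apply: cvgM; exact: coord.
have lim : (fun k => f (xs k) + dotp (vs k) (u - xs k) - l / 2 * dotp (u - xs k) (u - xs k))
    @ \oo --> f x + dotp v (u - x) - l / 2 * dotp (u - x) (u - x).
  apply: cvgB; first by apply: cvgD => //; exact: cdot.
  by apply: cvgM; [exact: cvg_cst|exact: cdot].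
rewrite enorm2E; apply: (cvgr_to_le lim).
have xU : \forall k \near \oo, U (xs k) by apply: xsx; exact: open_nbhs_nbhs.
apply: (filterS _ xU) => k Uk /=; rewrite -enorm2E.
by apply: (weakly_convex_ray cU wf) => //; exact: frechet_ray (Hsub k).
Qed.

(** Moving from [x] in the direction of the subgradient [v] itself increases [f] at
rate [enorm v], which the Lipschitz constant bounds. *)
Lemma weak_subgradient_bound U (l G : R) f x v : open U -> U x -> 0 <= G ->
  (forall y z, U y -> U z -> `|f y - f z| <= G * enorm (y - z)) ->
  (forall u, U u -> f x + dotp v (u - x) - l / 2 * enorm (u - x) ^+ 2 <= f u) ->
  enorm v <= G.
Proof.
move=> oU Ux G0 fL H.
have /enorm_nbhsP[r r0 Hr] : nbhs x U by exact: open_nbhs_nbhs.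
have [->//|v0] := eqVneq (enorm v) 0.
have vp : 0 < enorm v by rewrite lt_def v0 enorm_ge0.
rewrite -subr_le0; apply: (@le0_small _ (r / enorm v) _ (l / 2 * enorm v)).
  by rewrite divr_gt0.
move=> t /andP[t0]; rewrite ltr_pdivlMr// => tr.
have xt : x + t *: v - x = t *: v by rewrite addrC addKr.
have Ut : U (x + t *: v) by apply: Hr; rewrite xt enormZ gtr0_norm.
have := H _ Ut; have := fL _ _ Ut Ux.
rewrite xt enormZ (gtr0_norm t0) dotpZr -enorm2E ler_norml => /andP[_ H1] H2.
rewrite -(ler_pM2l t0) -(ler_pM2l vp); nra.
Qed.

Lemma convex_gradient_ineq U f x u : convex_set U -> convex_function U f ->
  differentiable f x -> U x -> U u -> f x + dotp (gradient f x) (u - x) <= f u.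
Proof.
move=> cU cf df Ux Uu.
have wf : weakly_convex U 0 f.
  apply/convex_functionP => y z t Uy Uz t01; rewrite !mul0r !addr0.
  by move/convex_functionP: cf; exact.
have := weakly_convex_ray cU wf Ux Uu (gradient_ray (u - x) df).
by rewrite !mul0r subr0.
Qed.

End Calculus.

Section Softplus.
Context {R : realType}.
Variables (lam gam : R).
Hypotheses (lam0 : 0 < lam) (gam0 : 0 < gam).

Local Notation p := (softplus lam gam).
Definition softplus_slope (u : R) : R :=
  lam * (expR (lam * u / gam) / (1 + expR (lam * u / gam))).

Lemma one_expR_gt0 (x : R) : 0 < 1 + expR x.
Proof. by rewrite addr_gt0 ?expR_gt0. Qed.

Lemma softplus_slope_ge0 u : 0 <= softplus_slope u.
Proof. by rewrite mulr_ge0 ?(ltW lam0)// divr_ge0 ?expR_ge0 ?(ltW (one_expR_gt0 _)). Qed.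

Lemma softplus_slope_le u : softplus_slope u <= lam.
Proof.
by rewrite ger_pMr// ler_pdivrMr ?one_expR_gt0// mul1r lerDr.
Qed.

Lemma is_derive_softplus (u : R) : is_derive u 1 p (softplus_slope u).
Proof.
have D1 : is_derive u 1 (fun u => lam * u / gam) (lam / gam).
  have -> : (fun u => lam * u / gam) = (fun u => (lam / gam) *: u).
    by apply/funext => x; rewrite /GRing.scale /= mulrAC.
  by apply: is_derive_eq; rewrite /GRing.scale /= mulr1.
have D2 := @is_derive1_comp R (@expR R) (fun u => lam * u / gam) u _ _ (is_derive_expR _) D1.
have D3 : is_derive u 1 (fun u => 1 + expR (lam * u / gam)) (expR (lam * u / gam) * (lam / gam)).
  by have := is_deriveD (is_derive_cst (1 : R) u 1) D2; rewrite add0r.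
have D4 := @is_derive1_comp R (@ln R) (fun u => 1 + expR (lam * u / gam)) u _ _
  (is_derive1_ln (one_expR_gt0 _)) D3.
have D5 : is_derive u 1 p (gam *: ((1 + expR (lam * u / gam))^-1 * (expR (lam * u / gam) * (lam / gam)))).
  exact: is_deriveZ.
apply: is_derive_eq; rewrite /softplus_slope /GRing.scale /=.
by field; rewrite !gt_eqF// one_expR_gt0.
Qed.

(** Convexity of the softplus. With [s = expR a / (1 + expR a)] this is the convexity of the exponential,
[expR (s * c) <= 1 - s + s * expR c] for [c = b - a]. *)
Lemma softplus_tangent u w : p u + softplus_slope u * (w - u) <= p w.
Proof.
rewrite /softplus /softplus_slope; set a := lam * u / gam; set b := lam * w / gam.
set s := expR a / (1 + expR a).
have -> : lam * s * (w - u) = gam * (s * (b - a)).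
  by rewrite /a /b; field; rewrite gt_eqF.
rewrite -mulrDr ler_pM2l// -ler_expR expRD !lnK ?posrE ?one_expR_gt0//.
have s0 : 0 <= s by rewrite divr_ge0 ?expR_ge0 ?(ltW (one_expR_gt0 _)).
have s1 : s <= 1 by rewrite ler_pdivrMr ?one_expR_gt0// mul1r lerDr.
have : expR (s * (b - a)) <= s * expR (b - a) + (1 - s).
  have := @convex_expR R (Itv01 s0 s1) (b - a) 0; rewrite !convRE /= expR0.
  by rewrite mulr0 addr0 mulr1.
rewrite -(ler_pM2l (one_expR_gt0 a)) => /le_trans; apply.
rewrite expRB /s le_eqVlt; apply/orP; left; apply/eqP.
by field; rewrite !gt_eqF// ?one_expR_gt0 ?expR_gt0.
Qed.

Lemma softplus_mono u w : u <= w -> p u <= p w.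
Proof.
move=> uw; apply: le_trans (softplus_tangent u w).
by rewrite lerDl mulr_ge0 ?softplus_slope_ge0 ?subr_ge0.
Qed.

Lemma softplus_convex u w t : 0 <= t <= 1 ->
  p (t * u + (1 - t) * w) <= t * p u + (1 - t) * p w.
Proof.
move=> /andP[t0 t1]; set x := t * u + _.
have := softplus_tangent x u; have := softplus_tangent x w.
move: (p x) (p u) (p w) (softplus_slope x) => a b c s H1 H2; subst x; nra.
Qed.

Lemma softplus_ge u : lam * Num.max u 0 <= p u.
Proof.
rewrite -(ler_pM2l (_ : 0 < gam^-1)) ?invr_gt0// mulKf ?gt_eqF//.
rewrite -ler_expR lnK ?posrE ?one_expR_gt0//.
rewrite maxEle; case: ifPn => _; first by rewrite !mulr0 expR0 lerDl expR_ge0.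
by rewrite mulrC lerDr.
Qed.

Lemma softplus_le u : p u <= lam * Num.max u 0 + gam * ln 2.
Proof.
rewrite -(ler_pM2l (_ : 0 < gam^-1)) ?invr_gt0// mulrDr !mulKf ?gt_eqF//.
rewrite -ler_expR expRD !lnK ?posrE ?one_expR_gt0//.
have e1 : expR (lam * u / gam) <= expR (gam^-1 * (lam * Num.max u 0)).
  rewrite ler_expR mulrC ler_pM2l ?invr_gt0// ler_pM2l// le_max lexx//.
have e2 : 1 <= expR (gam^-1 * (lam * Num.max u 0)).
  by rewrite -expR0 ler_expR !mulr_ge0 ?invr_ge0 ?(ltW gam0) ?(ltW lam0)// le_max lexx orbT.
lra.
Qed.

Lemma softplus_slope_continuous : continuous softplus_slope.
Proof.
move=> u; apply: cvgM; first exact: cvg_cst.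
have ce : {for u, continuous (fun u => expR (lam * u / gam))}.
  apply: continuous_comp; last exact: continuous_expR.
  apply: cvgM; last exact: cvg_cst.
  by apply: cvgM; [exact: cvg_cst|exact: cvg_id].
apply: cvgM; first exact: ce.
apply: cvgV; first by rewrite gt_eqF// one_expR_gt0.
by apply: cvgD; [exact: cvg_cst|exact: ce].
Qed.

Lemma gradient_softplus_comp d (g : 'rV[R]_d -> R) x : differentiable g x ->
  gradient (p \o g) x = softplus_slope (g x) *: gradient g x.
Proof.
move=> dg; have dp : differentiable p (g x).
  by apply/derivable1_diffP; have := is_derive_softplus (g x).
apply/rowP => i; rewrite !mxE deriveE; last exact: differentiable_comp.
rewrite diff_comp//= deriveE// diff1E// derive1E.
by have := is_derive_softplus (g x) => ?; rewrite derive_val /GRing.scale /= mulrC.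
Qed.

End Softplus.

(** * The penalized problem and its proximal points *)

Record constrained_problem {R : realType} {d : nat} (l Gf Gg sigma : R)
    (f g : 'rV[R]_d -> R) (U : set 'rV[R]_d) : Prop := ConstrainedProblem {
  cp_l : 0 < l; cp_Gf : 0 < Gf; cp_Gg : 0 < Gg; cp_sigma : 0 < sigma;
  cp_closed : closed [set x | g x <= 0];
  cp_ball : [set x | g x <= 0] `<=` unit_ball;
  cp_nonempty : [set x | g x <= 0] !=set0;
  cp_open : open U; cp_convex : convex_set U; cp_sub : unit_ball `<=` U;
  cp_weak : weakly_convex U l f;
  cp_lip : forall x y, U x -> U y -> `|f x - f y| <= Gf * enorm (x - y);
  cp_gconv : convex_function U g;
  cp_gdiff : forall x, U x -> differentiable g x;
  cp_gcont : forall x, U x -> {for x, continuous (gradient g)};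
  cp_gub : forall x, unit_ball x -> enorm (gradient g x) <= Gg;
  cp_glb : forall x, unit_ball x -> g x = 0 -> sigma <= enorm (gradient g x);
  cp_fdiff : forall x, U x -> differentiable f x;
  cp_fsmooth : forall x y, U x -> U y ->
    enorm (gradient f x - gradient f y) <= l * enorm (x - y) }.

Section Penalty.
Context {R : realType} {d : nat}.
Local Notation V := 'rV[R]_d.
Variables (l Gf Gg sigma : R) (f g : V -> R) (U : set V).
Hypothesis cp : constrained_problem l Gf Gg sigma f g U.
Implicit Types (x y z u w : V) (q : R -> R).

Local Notation B := (unit_ball : set V).
Local Notation C := [set x : V | g x <= 0].
Local Notation lam0 := (lambda0 l Gf sigma).

Let l0 : 0 < l := cp_l cp.
Let BU : B `<=` U := cp_sub cp.
Let CB : C `<=` B := cp_ball cp.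
Let CU x : C x -> U x. Proof. by move/CB/BU. Qed.

Lemma GF_gt0 : 0 < GF l Gf.
Proof. by have := cp_Gf cp; rewrite /GF; have := l0; lra. Qed.

Lemma lambda0_gt0 : 0 < lam0.
Proof. by rewrite divr_gt0 ?mulr_gt0 ?(cp_sigma cp)// GF_gt0. Qed.

Lemma convex_feasible : convex_set C.
Proof.
apply/convex_setP => x y t /= gx gy t01.
have /convex_functionP H := cp_gconv cp.
apply: le_trans (H _ _ _ (CU gx) (CU gy) t01) _; case/andP: t01 => t0 t1; nra.
Qed.

Let nearestC x : projset C x (nearest C x).
Proof. exact: nearestP (cp_closed cp) CB (cp_nonempty cp) x. Qed.

(** The boundary points of the feasible set that are nearest to an outside point [z]
see [z] in the direction of the outer normal [gradient g]: every direction that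
decreases [g] makes an obtuse angle with [z - y]. *)
Lemma nearest_normal z y : B z -> projset C z y -> g y = 0 ->
  enorm (gradient g y) * enorm (z - y) <= dotp (gradient g y) (z - y).
Proof.
move=> Bz pzy gy0; have [gy ymin] := pzy.
set n := gradient g y; set a := z - y.
have By : B y by exact: CB.
have n0 : 0 < enorm n by apply: lt_le_trans (cp_glb cp By gy0); exact: cp_sigma cp.
have obtuse u : dotp n u < 0 -> dotp a u <= 0.
  move=> nu.
  have e0 : 0 < - dotp n u / 2 by rewrite divr_gt0// oppr_gt0.
  have [r r0 Hr] := directional_expansion u (cp_gdiff cp (BU By)) e0.
  have t0 : 0 < r / 2 by rewrite divr_gt0.
  have := Hr (r / 2); rewrite t0 /= ltr_pdivrMr// ltr_pMr// ltr1n => /(_ isT).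
  rewrite gy0 subr0 ler_norml -/n => /andP[_ Hg].
  have Ct : C (y + (r / 2) *: u) by rewrite /=; nra.
  have := projset_var convex_feasible pzy Ct.
  have -> : y + (r / 2) *: u - y = (r / 2) *: u by rewrite addrC addKr.
  by rewrite dotpZr pmulr_rle0.
have nn : 0 < dotp n n by rewrite -enorm2E exprn_gt0.
clearbody a n.
have an : 0 <= dotp n a.
  have := obtuse (- n); rewrite !dotpNr oppr_lt0 oppr_le0 dotpC; exact.
have key : dotp a a * dotp n n <= dotp n a ^+ 2.
  have H t : 0 < t < 1 -> dotp a a - dotp n a ^+ 2 / dotp n n <= t * dotp n a.
    move=> /andP[t0 _].
    have := obtuse (a - (dotp n a / dotp n n + t) *: n).
    rewrite !dotpE (dotpC a n) mulrDl divfK ?gt_eqF// => H.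
    have : dotp n a + - (dotp n a + t * dotp n n) < 0 by rewrite subr_lt0 ltrDl mulr_gt0.
    by move/H; rewrite mulrDl expr2 mulrAC; lra.
  have := @le0_small _ _ _ _ ltr01 H.
  by rewrite subr_le0 ler_pdivlMr.
rewrite -ler_sqr ?nnegrE ?mulr_ge0 ?enorm_ge0// exprMn !enorm2E mulrC.
exact: key.
Qed.

(** Linear growth of the constraint away from the feasible set: the normal bounds
below the increase of the convex function [g] between [z] and its projection. *)
Lemma feasible_error_bound z : B z ->
  sigma * enorm (z - nearest C z) <= Num.max (g z) 0.
Proof.
move=> Bz; have pz := nearestC z; set y := nearest C z in pz *.
have Cy : C y by case: pz.
have [Cz|gz] := leP (g z) 0.
  by rewrite /y nearest_id// ?subrr ?enorm0 ?mulr0// ?convex_feasible//;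
    [exact: cp_closed cp|exact: cp_nonempty cp].
have By := CB Cy; have Uy := BU By.
have gy0 : g y = 0.
  apply/eqP; rewrite eq_le [g y <= 0]Cy /= leNgt; apply/negP => gy.
  (* otherwise a small step towards [z] stays feasible, by convexity of [g] *)
  pose t := - g y / (g z - g y).
  have zy : 0 < g z - g y by rewrite subr_gt0 (lt_trans gy).
  have t0 : 0 < t by rewrite divr_gt0// oppr_gt0.
  have t1 : t <= 1 by rewrite ler_pdivrMr//; lra.
  have t01 : 0 <= t <= 1 by rewrite ltW.
  have Ct : C (t *: z + (1 - t) *: y).
    have /convex_functionP H := cp_gconv cp.
    apply: le_trans (H _ _ _ (BU Bz) Uy t01) _.
    rewrite le_eqVlt; apply/orP; left; apply/eqP; rewrite /t; field; by rewrite gt_eqF.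
  have := projset_var convex_feasible pz Ct.
  have -> : t *: z + (1 - t) *: y - y = t *: (z - y).
    by apply/rowP => i; rewrite !mxE; ring.
  rewrite dotpZr pmulr_rle0// -enorm2E exprn_even_le0//= => /eqP/enorm_eq0/eqP.
  by rewrite subr_eq0 => /eqP zy'; move: gz; rewrite zy' ltNge Cy.
have := convex_gradient_ineq (cp_convex cp) (cp_gconv cp) (cp_gdiff cp Uy) Uy (BU Bz).
rewrite gy0 add0r; apply: le_trans.
apply: le_trans (nearest_normal Bz pz gy0).
by rewrite ler_wpM2r ?enorm_ge0// (cp_glb cp).
Qed.

(** A convex nondecreasing penalty keeps the subproblems strongly convex: half of the
quadratic term compensates the weak convexity of [f]. *)
Lemma subproblem_strongly_convex q x :
  (forall s t, s <= t -> q s <= q t) ->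
  (forall s t a, 0 <= a <= 1 -> q (a * s + (1 - a) * t) <= a * q s + (1 - a) * q t) ->
  strongly_convex U l (subproblem f g q (2 * l) x).
Proof.
move=> qmono qconv; apply/convex_functionP => y z t Uy Uz t01.
have /convex_functionP wf := cp_weak cp.
have /convex_functionP gc := cp_gconv cp.
have := wf _ _ _ Uy Uz t01.
have := le_trans (qmono _ _ (gc _ _ _ Uy Uz t01)) (qconv _ _ _ t01).
rewrite /subproblem !enorm2E !dotpE !(dotpC x) (dotpC z y).
lra.
Qed.

Lemma strongly_convexW (D D' : set V) (m : R) (h : V -> R) : D `<=` D' ->
  strongly_convex D' m h -> strongly_convex D m h.
Proof.
move=> DD' /convex_functionP H; apply/convex_functionP => x y t Dx Dy.
by apply: H; exact: DD'.
Qed.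

(** The subproblem with no penalty, to be minimized over the feasible set, and
with the exact penalty, to be minimized over the ball: by exact penalization both
have the minimizer [prox x]. *)
Definition prox_objective x : V -> R := subproblem f g (fun=> 0) (2 * l) x.
Definition penalized x : V -> R :=
  subproblem f g (fun s => lam0 * Num.max s 0) (2 * l) x.
Definition prox x : V := xget 0 (argmin C (prox_objective x)).

Lemma prox_objectiveE x z : prox_objective x z = f z + l * enorm (z - x) ^+ 2.
Proof. by rewrite /prox_objective /subproblem addr0; lra. Qed.

Lemma penalizedE x z :
  penalized x z = prox_objective x z + lam0 * Num.max (g z) 0.
Proof. by rewrite prox_objectiveE /penalized /subproblem; lra. Qed.

(** On the ball, [GF] is [Gf] plus the slope [l * 4] of the quadratic term, whose two
end points are at distance at most 2 from [x]. *)
Lemma prox_objective_lip x y z : B x -> B y -> B z ->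
  `|prox_objective x y - prox_objective x z| <= GF l Gf * enorm (y - z).
Proof.
move=> Bx By Bz; rewrite !prox_objectiveE.
have H1 := cp_lip cp (BU By) (BU Bz).
have H2 : `|dotp (y - z) ((y - x) + (z - x))| <= enorm (y - z) * 4.
  apply: le_trans (normr_dotp_le _ _) _; rewrite ler_wpM2l ?enorm_ge0//.
  apply: le_trans (enormD _ _) _.
  have := enormB_unit_ball By Bx; have := enormB_unit_ball Bz Bx; lra.
have -> : f y + l * enorm (y - x) ^+ 2 - (f z + l * enorm (z - x) ^+ 2)
    = (f y - f z) + l * dotp (y - z) ((y - x) + (z - x)).
  rewrite !enorm2E !dotpE !(dotpC x) (dotpC z y); lra.
apply: le_trans (ler_normD _ _) _; rewrite normrM gtr0_norm// /GF.
move: H1 H2; have := l0; nra.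
Qed.

Lemma proxP x : B x -> argmin C (prox_objective x) (prox x).
Proof.
move=> Bx; apply: xget_argmin; apply: (@argmin_nonempty _ _ _ _ (GF l Gf)).
- exact: cp_closed cp.
- exact: CB.
- exact: cp_nonempty cp.
- by move=> y z Cy Cz; apply: prox_objective_lip => //; exact: CB.
Qed.

Lemma prox_feasible x : B x -> C (prox x).
Proof. by case/proxP. Qed.

Lemma prox_objective_strongly_convex x : strongly_convex U l (prox_objective x).
Proof. by apply: subproblem_strongly_convex => // *; rewrite !mulr0 addr0. Qed.

Lemma penalized_strongly_convex x : strongly_convex U l (penalized x).
Proof.
have L := lambda0_gt0.
apply: subproblem_strongly_convex => [s t st|s t a /andP[a0 a1]].
  by rewrite ler_pM2l// ge_max !le_max st lexx orbT.
rewrite [leRHS](_ : _ = lam0 * (a * Num.max s 0 + (1 - a) * Num.max t 0)); last by lra.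
have s0 : s <= Num.max s 0 /\ 0 <= Num.max s 0 by rewrite !le_max !lexx orbT.
have t0 : t <= Num.max t 0 /\ 0 <= Num.max t 0 by rewrite !le_max !lexx orbT.
rewrite ler_pM2l// ge_max; apply/andP; split; nra.
Qed.

(** Exact penalization: leaving the feasible set gains at most [GF] per unit of distance
in the objective, while the penalty costs [2 GF] per unit by [feasible_error_bound]. *)
Lemma prox_penalized x : B x -> argmin B (penalized x) (prox x).
Proof.
move=> Bx; have [Cp pmin] := proxP Bx; split=> [|z Bz]; first exact: CB.
have [Cy _] := nearestC z; set y := nearest C z in Cy.
rewrite !penalizedE (max_r Cp) mulr0 addr0.
apply: le_trans (pmin _ Cy) _.
have H1 : lam0 * (sigma * enorm (z - y)) <= lam0 * Num.max (g z) 0.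
  by rewrite ler_pM2l ?lambda0_gt0// feasible_error_bound.
have H2 : lam0 * (sigma * enorm (z - y)) = 2 * GF l Gf * enorm (z - y).
  by rewrite /lambda0 /GF; field; rewrite gt_eqF// (cp_sigma cp).
have := prox_objective_lip Bx Bz (CB Cy); rewrite ler_norml => /andP[H3 _].
have := mulr_ge0 (ltW GF_gt0) (enorm_ge0 (z - y)).
lra.
Qed.

Lemma penalized_growth x z : B x -> B z ->
  penalized x (prox x) + l / 2 * enorm (z - prox x) ^+ 2 <= penalized x z.
Proof.
move=> Bx Bz; apply: strong_growth Bz; first exact: convex_unit_ball.
  by apply: strongly_convexW (penalized_strongly_convex x).
exact: prox_penalized.
Qed.

Lemma prox_dist x z e : B x -> B z -> penalized x z <= penalized x (prox x) + e ->
  l * enorm (z - prox x) ^+ 2 <= 2 * e.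
Proof. by move=> Bx Bz; have := penalized_growth Bx Bz; lra. Qed.

(** The potential of the outer loop. An inexact proximal step from [x] lowers it by
the squared distance from [x] to [prox x], up to the error [e]: compare the values
of the objective at [z], [prox x] and [x]. *)
Definition merit z : R := f z + lam0 * Num.max (g z) 0.

Lemma merit_descent x z e : B x -> B z ->
  penalized x z <= penalized x (prox x) + e ->
  merit z + l / 2 * enorm (x - prox x) ^+ 2 <= merit x + e.
Proof.
move=> Bx Bz; have := penalized_growth Bx Bx.
rewrite (penalizedE x x) (penalizedE x z) !prox_objectiveE subrr enorm0 expr0n /=.
rewrite /merit; have := mulr_ge0 (ltW l0) (sqr_ge0 (enorm (z - x))); lra.
Qed.

(** Add the growth inequalities at the two proximal points. This makes [prox] of a
random point a random vector. *)
Lemma prox_lip x y : B x -> B y -> enorm (prox x - prox y) <= 2 * enorm (x - y).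
Proof.
move=> Bx By.
have sc u : strongly_convex C l (prox_objective u).
  by apply: strongly_convexW (prox_objective_strongly_convex u); exact: CU.
have := strong_growth convex_feasible (sc x) (proxP Bx) (prox_feasible By).
have := strong_growth convex_feasible (sc y) (proxP By) (prox_feasible Bx).
rewrite !prox_objectiveE; move: (prox x) (prox y) => p r H1 H2.
have H : dotp (p - r) (p - r) <= 2 * dotp (x - y) (p - r).
  rewrite -(ler_pM2l l0); move: H1 H2.
  rewrite !enorm2E !dotpE (dotpC r p) !(dotpC _ x) !(dotpC _ y) ; lra.
have [->|n0] := eqVneq (enorm (p - r)) 0; first by rewrite mulr_ge0 ?enorm_ge0.
have n1 : 0 < enorm (p - r) by rewrite lt_def n0 enorm_ge0.
rewrite -(ler_pM2r n1) -expr2 enorm2E; apply: le_trans H _.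
by rewrite -mulrA ler_pM2l// dotp_le.
Qed.

(** The first-order optimality condition of the proximal point. *)
Lemma prox_stationary x u : B x -> C u ->
  0 <= dotp (gradient f (prox x) + (2 * l) *: (prox x - x)) (u - prox x).
Proof.
move=> Bx Cu; have [Cp pmin] := proxP Bx; set p := prox x in Cp pmin *.
rewrite -oppr_le0; set a := - _.
suff key e : 0 < e -> a <= e.
  by apply: (@le0_small _ 1 _ 1) => // t /andP[t0 _]; rewrite mulr1 key.
move=> e0; rewrite -subr_le0.
have [r r0 Hr] := directional_expansion (u - p) (cp_fdiff cp (CU Cp)) e0.
apply: (@le0_small _ (Num.min r 1) _ (l * dotp (u - p) (u - p))).
  by rewrite lt_min r0 ltr01.
move=> t /andP[t0]; rewrite lt_min => /andP[tr t1].
have t01 : 0 <= t <= 1 by rewrite !ltW.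
have Ct : C (t *: u + (1 - t) *: p) by move/convex_setP: convex_feasible; exact.
have H1 := pmin _ Ct; have := Hr t; rewrite t0 tr => /(_ isT).
have E : p + t *: (u - p) = t *: u + (1 - t) *: p.
  by rewrite scalerBr scalerBl scale1r addrCA addrA.
rewrite E ler_norml => /andP[_ H2]; rewrite -(ler_pM2l t0) /a; move: H1 H2.
rewrite !prox_objectiveE !enorm2E !dotpE !(dotpC x) (dotpC p u); lra.
Qed.

Let nearest_lipC y z : enorm (nearest C y - nearest C z) <= enorm (y - z).
Proof.
exact: nearest_lip (cp_closed cp) CB (cp_nonempty cp) convex_feasible y z.
Qed.

(** [prox x] is itself a projection, of the gradient step perturbed by
[2 (prox x - x)], so the gradient mapping at [prox x] only sees that perturbation. *)
Lemma grad_mapping_prox x : B x ->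
  grad_mapping C f l (prox x) <= 2 * l * enorm (prox x - x).
Proof.
move=> Bx; have Cp := prox_feasible Bx; set p := prox x.
set w := gradient f p + (2 * l) *: (p - x).
have pE : nearest C (p - l^-1 *: w) = p.
  apply: nearest_eq => //.
  - exact: cp_closed cp.
  - exact: cp_nonempty cp.
  move=> u Cu; rewrite addrC addKr dotpNl dotpZl oppr_le0.
  by rewrite mulr_ge0 ?invr_ge0 ?(ltW l0)// prox_stationary.
rewrite /grad_mapping -{1}pE mulrAC mulrC ler_pM2r// -/p.
apply: le_trans (nearest_lipC _ _) _.
have -> : p - l^-1 *: w - (p - l^-1 *: gradient f p) = - 2 *: (p - x).
  by apply/rowP => i; rewrite !mxE; field; rewrite gt_eqF.
by rewrite enormZ normrN ger0_norm.
Qed.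

(** The gradient step is 2-Lipschitz and the projection is nonexpansive. *)
Lemma grad_mapping_lip y z : U y -> U z ->
  `|grad_mapping C f l y - grad_mapping C f l z| <= 3 * l * enorm (y - z).
Proof.
have half u w : U u -> U w ->
    grad_mapping C f l u - grad_mapping C f l w <= 3 * l * enorm (u - w).
  move=> Uu Uw; rewrite /grad_mapping.
  set a := u - l^-1 *: _; set b := w - l^-1 *: _.
  have H1 := nearest_lipC a b.
  have H2 : enorm (a - b) <= 2 * enorm (u - w).
    have -> : a - b = (u - w) - l^-1 *: (gradient f u - gradient f w).
      by apply/rowP => i; rewrite !mxE; ring.
    apply: le_trans (enormB _ _) _; rewrite enormZ ger0_norm ?invr_ge0 ?(ltW l0)//.
    have := cp_fsmooth cp Uu Uw; rewrite -(ler_pM2l (_ : 0 < l^-1)) ?invr_gt0//.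
    rewrite mulKf ?gt_eqF//; lra.
  clearbody a b; move: (nearest C a) (nearest C b) H1 H2 => na nb H1 H2.
  have H3 := enorm_triangle w u na.
  have H4 := enorm_triangle nb w na.
  rewrite (enormBC nb) in H4.
  have : enorm (u - na) - enorm (w - nb) <= 3 * enorm (u - w) by lra.
  rewrite -(ler_pM2l l0); lra.
move=> Uy Uz; have := half y z Uy Uz; have := half z y Uz Uy.
rewrite (enormBC z y); move: (grad_mapping _ _ _ _) (grad_mapping _ _ _ _) => p r.
by move=> H1 H2; rewrite ler_norml; apply/andP; split; lra.
Qed.

Lemma grad_mapping_nearest x z : B x -> B z ->
  grad_mapping C f l (nearest C z) <=
    3 * l * enorm (z - prox x) + 2 * l * enorm (prox x - x).
Proof.
move=> Bx Bz; have Cp := prox_feasible Bx; have [Cy _] := nearestC z.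
have := grad_mapping_lip (CU Cy) (CU Cp); have := grad_mapping_prox Bx.
have H : enorm (nearest C z - prox x) <= enorm (z - prox x).
  have {1}-> : prox x = nearest C (prox x); last exact: nearest_lipC.
  by rewrite nearest_id//; [exact: cp_closed cp|exact: cp_nonempty cp].
rewrite -(ler_pM2l (_ : 0 < 3 * l)) ?mulr_gt0// in H.
move=> H1 /(le_trans (ler_norm _)); move: H H1.
move: (grad_mapping _ _ _ _) (grad_mapping _ _ _ _) (enorm _) => a b c; lra.
Qed.

End Penalty.

(** * One run of the inner subgradient method *)

Section Regret.
Context {R : realType} {d : nat}.
Local Notation V := 'rV[R]_d.
Implicit Types (x y z u : V) (H : V -> R).

Lemma sum_inv_le_ln (n : nat) :
  \sum_(j < n) (j.+2%:R : R)^-1 <= ln n.+1%:R.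
Proof.
elim: n => [|n IH]; first by rewrite big_ord0 ln1.
rewrite big_ord_recr /=; apply: le_trans (lerD IH (lexx _)) _.
rewrite addrC -lerBrDr -opprB -[X in _ <= - X]ln_div ?posrE// lerNr.
have -> : n.+1%:R / n.+2%:R = 1 + - (n.+2%:R : R)^-1.
  by rewrite -[in n.+1%:R](addn1 n) -[in n.+2%:R](addn2 n) !natrD; field; rewrite gt_eqF// ltr_wpDl.
by apply: le_ln1Dx; rewrite ltrN2 invf_lt1// ltr1n.
Qed.

(** Telescoping the distances [D j] to the comparison point with the steps
[2 / (m (j + 2))] leaves a surplus [- m / 4 * D j] in each round, which is kept on the
right-hand side to absorb the noise. *)
Lemma psm_regret H (m G : R) u (z h b : nat -> V) (n : nat) :
  0 < m -> unit_ball u ->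
  (forall j, (j < n)%N ->
    z j.+1 = nearest unit_ball (z j - (2 / (m * j.+2%:R)) *: h j)) ->
  (forall j, (j < n)%N -> enorm (h j) <= G) ->
  (forall j, (j < n)%N ->
    H (z j) + dotp (b j) (u - z j) + m / 2 * enorm (u - z j) ^+ 2 <= H u) ->
  \sum_(j < n) (H (z j) - H u) <=
    m / 4 * enorm (z 0%N - u) ^+ 2 + G ^+ 2 / m * ln n.+1%:R +
    \sum_(j < n) (dotp (b j - h j) (z j - u) - m / 4 * enorm (z j - u) ^+ 2).
Proof.
move=> m0 Bu zS hG bsub.
suff : \sum_(j < n) (H (z j) - H u) + m / 4 * n.+1%:R * enorm (z n - u) ^+ 2 <=
    m / 4 * enorm (z 0%N - u) ^+ 2 + G ^+ 2 / m * \sum_(j < n) (j.+2%:R : R)^-1 +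
    \sum_(j < n) (dotp (b j - h j) (z j - u) - m / 4 * enorm (z j - u) ^+ 2).
  have : G ^+ 2 / m * \sum_(j < n) (j.+2%:R : R)^-1 <= G ^+ 2 / m * ln n.+1%:R.
    by rewrite ler_wpM2l ?sum_inv_le_ln// divr_ge0 ?sqr_ge0// ltW.
  have : 0 <= m / 4 * n.+1%:R * enorm (z n - u) ^+ 2.
    by rewrite mulr_ge0 ?sqr_ge0// mulr_ge0// divr_ge0// ltW.
  lra.
elim: n zS hG bsub => [|n IH] zS hG bsub; first by rewrite !big_ord0; lra.
have {IH} := IH (fun j jn => zS j (ltnW jn)) (fun j jn => hG j (ltnW jn))
  (fun j jn => bsub j (ltnW jn)).
rewrite !big_ord_recr /= [G ^+ 2 / m * (_ + _)]mulrDr.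
have c0 : 0 < m * n.+2%:R by rewrite mulr_gt0.
set eta := 2 / (m * n.+2%:R).
have step : enorm (z n.+1 - u) ^+ 2 <=
    enorm (z n - u) ^+ 2 - 2 * eta * dotp (h n) (z n - u) + eta ^+ 2 * G ^+ 2.
  have : enorm (z n.+1 - u) <= enorm (z n - eta *: h n - u).
    rewrite zS// -{1}(nearest_id closed_unit_ball (@subset_refl _ _) (ex_intro _ u Bu) Bu).
    apply: nearest_lip => //; [exact: closed_unit_ball|by exists u|exact: convex_unit_ball].
  rewrite -ler_sqr ?nnegrE ?enorm_ge0// => /le_trans; apply.
  have hn2 : enorm (h n) ^+ 2 <= G ^+ 2.
    by rewrite ler_sqr ?nnegrE ?enorm_ge0 ?hG// (le_trans (enorm_ge0 (h n)))// hG.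
  have : eta ^+ 2 * enorm (h n) ^+ 2 <= eta ^+ 2 * G ^+ 2 by rewrite ler_wpM2l ?sqr_ge0.
  rewrite !enorm2E !dotpE !(dotpC (h n)) (dotpC u (z n)); lra.
have {}step : m * n.+2%:R / 4 * enorm (z n.+1 - u) ^+ 2 <=
    m * n.+2%:R / 4 * enorm (z n - u) ^+ 2 - dotp (h n) (z n - u) + G ^+ 2 / m / n.+2%:R.
  have c4 : 0 < m * n.+2%:R / 4 by rewrite divr_gt0.
  rewrite -(ler_pM2l c4) in step; apply: le_trans step _.
  rewrite le_eqVlt; apply/orP; left; apply/eqP; rewrite /eta.
  by field; rewrite !gt_eqF// ltr_wpDl.
have := bsub n (ltnSn n); rewrite (enormBC u) -(opprB (z n) u) dotpNr.
rewrite [dotp (b n - h n) _]dotpDl dotpNl.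
have := natr1 n.+1 : _ = _ :> R; move: step; move: (n.+2%:R) (n.+1%:R) => N2 N1 + N.
rewrite -N; lra.
Qed.

Lemma average_unit_ball (z : nat -> V) (n : nat) : (0 < n)%N ->
  (forall j, (j < n)%N -> unit_ball (z j)) ->
  unit_ball (n%:R^-1 *: \sum_(j < n) z j).
Proof.
move=> n0 zB; rewrite /unit_ball /= enormZ gtr0_norm ?invr_gt0 ?ltr0n//.
rewrite ler_pdivrMl ?ltr0n// mulr1; apply: le_trans (enorm_sum _ _) _.
have -> : n%:R = \sum_(j < n) (1 : R) by rewrite sumr_const card_ord.
by apply: ler_sum => j _; exact: zB.
Qed.

(** Jensen's inequality, from a subgradient at the average. *)
Lemma average_le H b (z : nat -> V) (n : nat) (a := n%:R^-1 *: \sum_(j < n) z j) :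
  (0 < n)%N -> (forall j, (j < n)%N -> H a + dotp b (z j - a) <= H (z j)) ->
  n%:R * H a <= \sum_(j < n) H (z j).
Proof.
move=> n0 sub.
have -> : n%:R * H a = \sum_(j < n) (H a + dotp b (z j - a)).
  rewrite big_split /= sumr_const card_ord -[H a *+ n]mulr_natl.
  have -> : \sum_(j < n) dotp b (z j - a) = dotp b (\sum_(j < n) (z j - a)).
    elim/big_rec2: _ => [|j y x _ ->]; first by rewrite dotp0r.
    by rewrite [RHS]dotpDr.
  rewrite sumrB sumr_const card_ord -[a *+ n]scaler_nat /a scalerA divff ?gt_eqF ?ltr0n//.
  by rewrite scale1r subrr dotp0r addr0.
by apply: ler_sum => j _; exact: sub.
Qed.

End Regret.

Section PSM.
Context {R : realType} {d : nat}.
Local Notation V := 'rV[R]_d.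
Variables (l Gf Gg sigma : R) (f g : V -> R) (U : set V) (v : V -> V).
Hypothesis cp : constrained_problem l Gf Gg sigma f g U.
Hypothesis vsub : forall x, unit_ball x -> limiting_subdiff f x (v x).
Variable K : nat.
Hypothesis K0 : (0 < K)%N.
Implicit Types (x y z u w a : V).

Local Notation B := (unit_ball : set V).
Local Notation lam0 := (lambda0 l Gf sigma).
Local Notation p := (softplus lam0 K%:R^-1).

Let l0 : 0 < l := cp_l cp.
Let BU : B `<=` U := cp_sub cp.
Let lam_gt0 := lambda0_gt0 cp.
Let gam_gt0 : 0 < K%:R^-1 :> R. Proof. by rewrite invr_gt0 ltr0n. Qed.

Lemma oracle_mean_subgradient z u : B z -> U u ->
  f z + dotp (v z) (u - z) - l / 2 * enorm (u - z) ^+ 2 <= f u.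
Proof.
move=> Bz Uu; exact: (weakly_convex_limiting (cp_open cp) (cp_convex cp)
  (cp_weak cp) (BU Bz) Uu (vsub Bz)).
Qed.

Lemma oracle_mean_bound z : B z -> enorm (v z) <= Gf.
Proof.
move=> Bz; apply: (@weak_subgradient_bound _ _ U l Gf f z).
- exact: cp_open cp.
- exact: BU.
- exact: ltW (cp_Gf cp).
- exact: cp_lip cp.
- by move=> u; exact: oracle_mean_subgradient.
Qed.

Definition psm_direction x z a : V :=
  a + (2 * l) *: (z - x) + gradient (p \o g) z.

Lemma psm_direction_bound x z a : B x -> B z -> enorm a <= Gf ->
  enorm (psm_direction x z a) <= GH l Gf Gg sigma.
Proof.
move=> Bx Bz aG; rewrite /GH /GF /psm_direction.
apply: le_trans (enormD _ _) _; apply: lerD.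
  apply: le_trans (enormD _ _) _; apply: lerD => //.
  rewrite enormZ gtr0_norm ?mulr_gt0//; have := enormB_unit_ball Bz Bx.
  by have := l0; nra.
rewrite gradient_softplus_comp//; last exact: (cp_gdiff cp (BU Bz)).
rewrite enormZ ger0_norm ?softplus_slope_ge0//.
by apply: ler_pM; rewrite ?softplus_slope_ge0 ?enorm_ge0 ?softplus_slope_le ?(cp_gub cp).
Qed.

Lemma subproblem_subgradient x z u : B z -> B u ->
  subproblem f g p (2 * l) x z + dotp (psm_direction x z (v z)) (u - z) +
    l / 2 * enorm (u - z) ^+ 2 <= subproblem f g p (2 * l) x u.
Proof.
move=> Bz Bu; rewrite /subproblem /psm_direction.
have H1 := oracle_mean_subgradient Bz (BU Bu).
have dg := cp_gdiff cp (BU Bz).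
have H2 : p (g z) + dotp (gradient (p \o g) z) (u - z) <= p (g u).
  rewrite gradient_softplus_comp// dotpZl.
  apply: le_trans (softplus_tangent lam0 gam_gt0 (g z) (g u)).
  rewrite lerD2l ler_wpM2l ?softplus_slope_ge0//.
  have := convex_gradient_ineq (cp_convex cp) (cp_gconv cp) dg (BU Bz) (BU Bu).
  lra.
move: H1 H2; rewrite [dotp (_ + _ + _) _]dotpDl [dotp (_ + _) (u - z)]dotpDl dotpZl.
set A := dotp (v z) _; set D := dotp (gradient _ _) _.
rewrite !enorm2E !dotpE !(dotpC x) (dotpC z u); lra.
Qed.

Definition psm_step x (s : nat) z a : V :=
  nearest unit_ball (z - (2 / (l * s.+1%:R)) *: psm_direction x z a).

Lemma psm_step_ball x s z a : B (psm_step x s z a).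
Proof.
exact: (nearest_in closed_unit_ball (@subset_refl _ _) (ex_intro _ 0 unit_ball0)).
Qed.

(** The regret bound for the smoothed subproblem, Jensen's inequality for the average,
and the sandwich of the softplus between the exact penalty and the exact penalty
plus [ln 2 / K]. The hypothesis on the noise is what holds with high probability. *)
Lemma psm_certificate x (z a : nat -> V) (delta : R) (y := K%:R^-1 *: \sum_(j < K) z j) :
  B x -> z 0%N = x -> (forall j, (j < K)%N -> z j.+1 = psm_step x j.+1 (z j) (a j)) ->
  (forall j, (j < K)%N -> enorm (a j) <= Gf) ->
  \sum_(j < K) (dotp (v (z j) - a j) (z j - prox l f g x) -
    l / 4 * enorm (z j - prox l f g x) ^+ 2) <=
    2 * GH l Gf Gg sigma ^+ 2 / l * ln delta^-1 ->
  penalized l Gf sigma f g x y <=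
    penalized l Gf sigma f g x (prox l f g x) + e_ K l Gf Gg sigma delta.
Proof.
move=> Bx z0 zS aG noise.
set u := prox l f g x in noise *.
have Bu : B u by apply: (cp_ball cp); exact: (prox_feasible cp Bx).
have zB j : (j <= K)%N -> B (z j).
  by case: j => [|j] jK; [rewrite z0|rewrite zS//; exact: psm_step_ball].
have By : B y by apply: average_unit_ball => // j /ltnW; exact: zB.
have hG j : (j < K)%N -> enorm (psm_direction x (z j) (a j)) <= GH l Gf Gg sigma.
  by move=> jK; apply: psm_direction_bound => //; [exact: zB (ltnW jK)|exact: aG].
have sub j : (j < K)%N -> subproblem f g p (2 * l) x (z j) +
    dotp (psm_direction x (z j) (v (z j))) (u - z j) + l / 2 * enorm (u - z j) ^+ 2 <=
    subproblem f g p (2 * l) x u.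
  by move=> jK; apply: subproblem_subgradient => //; exact: zB (ltnW jK).
have := psm_regret l0 Bu zS hG sub.
under [X in _ <= _ + X]eq_bigr => j _.
  have -> : psm_direction x (z j) (v (z j)) - psm_direction x (z j) (a j) = v (z j) - a j.
    by apply/rowP => i; rewrite !mxE; ring.
  over.
have avg := @average_le _ _ (subproblem f g p (2 * l) x) (psm_direction x y (v y)) z K K0.
rewrite -/y in avg.
have {}avg : K%:R * subproblem f g p (2 * l) x y <= \sum_(j < K) subproblem f g p (2 * l) x (z j).
  apply: avg => j jK; have := subproblem_subgradient x By (zB _ (ltnW jK)).
  by apply: le_trans; rewrite lerDl mulr_ge0 ?sqr_ge0// divr_ge0// ltW.
rewrite sumrB sumr_const card_ord -[subproblem _ _ _ _ _ u *+ K]mulr_natl.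
have D0 : l / 4 * enorm (z 0%N - u) ^+ 2 <= l.
  have H4 : 0 <= l * (4 - enorm (x - u) ^+ 2).
    apply: mulr_ge0; first exact: ltW.
    have := enormB_unit_ball Bx Bu; have := enorm_ge0 (x - u); nra.
  by rewrite z0; lra.
move=> reg.
have Hy : penalized l Gf sigma f g x y <= subproblem f g p (2 * l) x y.
  by rewrite /penalized /subproblem lerD2r lerD2l softplus_ge.
have Hu : subproblem f g p (2 * l) x u <= penalized l Gf sigma f g x u + ln 2 / K%:R.
  rewrite /penalized /subproblem; have := softplus_le lam_gt0 gam_gt0 (g u).
  by rewrite (mulrC K%:R^-1); lra.
have KR : 0 < K%:R :> R by rewrite ltr0n.
suff : subproblem f g p (2 * l) x y <= subproblem f g p (2 * l) x u + U_ K l (GH l Gf Gg sigma) delta.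
  by rewrite /e_; move: Hy Hu; lra.
have UK : K%:R * U_ K l (GH l Gf Gg sigma) delta =
    l + GH l Gf Gg sigma ^+ 2 / l * (ln K.+1%:R + 2 * ln delta^-1).
  by rewrite /U_ mulrC divfK ?gt_eqF.
rewrite -(ler_pM2l KR) [leRHS]mulrDr UK.
by move: avg reg noise D0; lra.
Qed.

End PSM.

(** * The trajectory generated by a sequence of oracle answers *)

Section Trajectory.
Context {R : realType} {d : nat}.
Local Notation V := 'rV[R]_d.
Variables (l : R) (f g : V -> R) (p : R -> R) (T K : nat) (C : set V).
Variable ans : nat -> V -> V.
Implicit Types (x z acc : V) (n c j t : nat) (k : V -> @prog R d).

(** The inner iterate reached from [x] after [j] queries, the first of which has
number [n]. *)
Fixpoint inner_iterate n x j : V :=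
  if j isn't j'.+1 then x else
  let z := inner_iterate n x j' in
  nearest unit_ball (z - (2 / (l * j'.+2%:R)) *:
    (ans (n + j') z + (2 * l) *: (z - x) + gradient (p \o g) z)).

Definition inner_output n x : V := K%:R^-1 *: \sum_(j < K) inner_iterate n x j.

Fixpoint outer_iterate x0 t : V :=
  if t is t'.+1 then inner_output (t' * K) (outer_iterate x0 t') else x0.

(** Up to the final projection every program step is deterministic once the answers
are known, so an execution reduces to the explicit recursions above. *)
Lemma exec_psm_loop x n k r j c :
  exec ans C (psm_loop g p (2 * l) l K x r j.+1 (inner_iterate n x j)
    (\sum_(i < j) inner_iterate n x i) k) (n + j) c =
  exec ans C (k (K%:R^-1 *: \sum_(i < j + r) inner_iterate n x i)) (n + j + r) c.
Proof.
elim: r j => [|r IH] j; first by rewrite /= !addn0.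
rewrite [psm_loop _ _ _ _ _ _ _ _ _ _ _]/= [LHS]/=.
have -> : \sum_(i < j) inner_iterate n x i + inner_iterate n x j =
  \sum_(i < j.+1) inner_iterate n x i by rewrite big_ord_recr.
by have := IH j.+1; rewrite /= addnS !addSnnS => <-.
Qed.

Lemma exec_psm x n k c :
  exec ans C (psm g p (2 * l) l K x k) n c =
  exec ans C (k (inner_output n x)) (n + K) c.
Proof.
have := exec_psm_loop x n k K 0 c; rewrite big_ord0 addn0 add0n; exact.
Qed.

Lemma exec_outer_loop x0 (k : seq V -> @prog R d) r t c :
  exec ans C (outer_loop g p (2 * l) l K r [seq outer_iterate x0 i | i <- iota 0 t.+1]
    (outer_iterate x0 t) k) (t * K) c =
  exec ans C (k [seq outer_iterate x0 i | i <- iota 0 (t + r).+1]) ((t + r) * K) c.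
Proof.
elim: r t => [|r IH] t; first by rewrite /= !addn0.
rewrite [outer_loop _ _ _ _ _ _ _ _ _]/= exec_psm -/(outer_iterate x0 t.+1).
have -> : x0 :: rcons [seq outer_iterate x0 i | i <- iota 1 t] (outer_iterate x0 t.+1) =
    [seq outer_iterate x0 i | i <- iota 0 t.+2].
  by rewrite -rcons_cons -cats1 -[in RHS](addn1 t.+1) iotaD map_cat.
by have := IH t.+1; rewrite mulSnr addSnnS.
Qed.

Lemma exec_penalized_psm x0 J y n c :
  exec ans C (penalized_psm g p (2 * l) l T K x0 J) 0 0 (y, n, c) <->
  [/\ projset C (nth 0 [seq outer_iterate x0 i | i <- iota 0 T.+1] J) y,
      n = (T * K)%N & c = 1%N].
Proof.
rewrite /penalized_psm.
have := exec_outer_loop x0 (fun xs => Project (nth 0 xs J) Return) T 0 0.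
rewrite mul0n add0n => ->.
split=> [[z Cz [-> -> ->]]|[Cy -> ->]]; first by [].
by exists y.
Qed.

End Trajectory.

(** * Conditional expectations and an exponential supermartingale *)

Section SubSigmaAlgebra.
Context {R : realType} {dO : measure_display} {Omega : measurableType dO}.
Variable P : probability Omega R.
Implicit Types (F : set (set Omega)) (h W Y : Omega -> R) (c : R).

Definition adapted F h :=
  measurable_fun [set: g_sigma_algebraType F] (h : g_sigma_algebraType F -> R).

Lemma adapted_sub F F' h : F `<=` <<s F' >> -> adapted F h -> adapted F' h.
Proof.
move=> FF' ah _ S mS; have := ah measurableT S mS; rewrite !setTI.
by apply: smallest_sub => //; exact: smallest_sigma_algebra.
Qed.

Lemma adapted_measurable F h : F `<=` measurable -> adapted F h ->
  measurable_fun setT h.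
Proof.
move=> sF ah _ S mS; have := ah measurableT S mS; rewrite !setTI.
by apply: smallest_sub => //; exact: sigma_algebra_measurable.
Qed.

Lemma bounded_integrable h c : measurable_fun setT h -> (forall w, `|h w| <= c) ->
  P.-integrable setT (EFin \o h).
Proof.
move=> mh hc; apply: measurable_bounded_integrable => //.
  by apply: le_lt_trans (probability_le1 P measurableT) _; exact: ltry.
exists c; split; first exact: num_real.
by move=> M cM w _ /=; apply: le_trans (hc w) (ltW cM).
Qed.

Lemma integrable_bounded_mul W Y c : measurable_fun setT W ->
  (forall w, `|W w| <= c) -> P.-integrable setT (EFin \o Y) ->
  P.-integrable setT (EFin \o (fun w => W w * Y w)).
Proof.
move=> mW Wc iY.
have -> : EFin \o (fun w => W w * Y w) = ((EFin \o W) \* (EFin \o Y))%E.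
  by apply/funext => w /=; rewrite EFinM.
apply: integrableMr => //; exists c; split; first exact: num_real.
by move=> M cM w _ /=; apply: le_trans (Wc w) (ltW cM).
Qed.

Lemma Rintegral_sum (I : Type) (r : seq I) (h : I -> Omega -> R) :
  (forall i, P.-integrable setT (EFin \o h i)) ->
  P.-integrable setT (EFin \o (fun w => \sum_(i <- r) h i w)) /\
  \int[P]_w (\sum_(i <- r) h i w) = \sum_(i <- r) \int[P]_w h i w.
Proof.
move=> ih; elim: r => [|i r [IH1 IH2]].
  have -> : (fun w => \sum_(i <- [::]) h i w) = cst 0 by apply/funext => w; rewrite big_nil.
  split; first by apply: (@bounded_integrable _ 0) => // w; rewrite normr0.
  by rewrite big_nil Rintegral_cst// mul0r.
have -> : (fun w => \sum_(j <- i :: r) h j w) = fun w => h i w + \sum_(j <- r) h j w.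
  by apply/funext => w; rewrite big_cons.
split; first exact: (integrableD _ (ih i) IH1).
by rewrite big_cons -IH2 RintegralD.
Qed.

(** Staircase approximation of a bounded function by multiples of indicators of its
superlevel sets. *)
Lemma staircase c (n : nat) (t : R) : (0 < n)%N -> 0 <= t <= c ->
  let s := n%:R^-1 * \sum_(i < (Num.truncn (c * n%:R)).+1)
    (nat_of_bool (i.+1%:R / n%:R <= t))%:R in s <= t <= s + n%:R^-1.
Proof.
move=> n0 /andP[t0 tc] /=; have nR : 0 < n%:R :> R by rewrite ltr0n.
set q := Num.truncn (t * n%:R).
have tn0 : 0 <= t * n%:R by rewrite mulr_ge0.
have /andP[q1 q2] : q%:R <= t * n%:R < q.+1%:R by exact: truncn_itv.
have qN : (q <= (Num.truncn (c * n%:R)).+1)%N.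
  by rewrite leqW// le_truncn// ler_wpM2r.
have -> : \sum_(i < (Num.truncn (c * n%:R)).+1)
    (nat_of_bool (i.+1%:R / n%:R <= t))%:R = q%:R :> R.
  rewrite (eq_bigr (fun i : 'I__ => if (i < q)%N then 1 else 0)); last first.
    move=> i _; rewrite ler_pdivrMr//.
    have -> : (i.+1%:R <= t * n%:R) = (i < q)%N by rewrite -truncn_ge_nat.
    by case: ifP.
  rewrite -big_mkcond /= -(big_ord_widen _ (fun=> 1) qN).
  by rewrite sumr_const card_ord.
rewrite mulrC ler_pdivrMr// q1 /=.
by rewrite -[X in _ + X]mul1r -mulrDl ler_pdivlMr// natr1 ltW.
Qed.

(** Taking out what is known: a random variable with zero integral over every event of
a sigma-algebra is orthogonal to all bounded functions measurable for it. *)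
Lemma adapted_orthogonal F W Y c : F `<=` measurable -> adapted F W ->
  (forall w, 0 <= W w <= c) -> P.-integrable setT (EFin \o Y) ->
  (forall A, <<s F >> A -> \int[P]_(w in A) Y w = 0) ->
  \int[P]_w (W w * Y w) = 0.
Proof.
move=> sF aW Wc iY Y0.
have mW := adapted_measurable sF aW.
have sF' : <<s F >> `<=` measurable.
  by apply: smallest_sub => //; exact: sigma_algebra_measurable.
suff H n : (0 < n)%N -> `|\int[P]_w (W w * Y w)| <= n%:R^-1 * \int[P]_w `|Y w|.
  apply/eqP; rewrite -normr_le0.
  apply: (@le0_small _ 1 _ (\int[P]_w `|Y w| )) => // t /andP[t0 _].
  have := H (Num.truncn t^-1).+1 isT => /le_trans; apply.
  rewrite ler_wpM2r ?Rintegral_ge0// invf_ple ?posrE//.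
  by rewrite ltW// truncnS_gt.
move=> n0; set N := (Num.truncn (c * n%:R)).+1.
pose A i := [set w | i.+1%:R / n%:R <= W w].
have mA i : <<s F >> (A i).
  have := aW measurableT `[i.+1%:R / n%:R, +oo[%classic (measurable_itv _).
  rewrite setTI; congr (<<s F >> _); apply/seteqP; split=> w /=;
    by rewrite in_itv/= andbT.
pose s w : R := n%:R^-1 * \sum_(i < N) \1_(A i) w.
have sW w : s w <= W w <= s w + n%:R^-1.
  have := staircase n0 (Wc w); rewrite /s /=.
  suff -> : \sum_(i < N) \1_(A i) w = \sum_(i < N) (nat_of_bool (i.+1%:R / n%:R <= W w))%:R :> R by [].
  by apply: eq_bigr => i _; rewrite indicE mem_setE.
have iI i : P.-integrable setT (EFin \o (fun w => \1_(A i) w * Y w)).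
  apply: (@integrable_bounded_mul _ _ 1) => //; first exact: measurable_indic (sF' _ (mA i)).
  by move=> w; rewrite indicE; case: (_ \in _); rewrite ?normr1 ?normr0.
have sY0 : \int[P]_w (s w * Y w) = 0.
  have -> : (fun w => s w * Y w) = fun w => n%:R^-1 * \sum_(i < N) (\1_(A i) w * Y w).
    by apply/funext => w; rewrite /s -mulrA mulr_suml.
  have [int eq0] := Rintegral_sum (index_enum 'I_N) (fun i : 'I_N => iI i).
  rewrite RintegralZl// eq0 big1 ?mulr0// => i _.
  rewrite -[RHS](Y0 _ (mA i)) [RHS]Rintegral_mkcond.
  apply: eq_Rintegral => w _; rewrite indicE patchE.
  by case: ifPn => _; rewrite ?mul1r ?mul0r.
have ms : measurable_fun setT s.
  apply: measurable_funM; first exact: measurable_cst.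
  by apply: measurable_sum => i; exact: measurable_indic (sF' _ (mA i)).
have sb w : `|W w - s w| <= n%:R^-1.
  have /andP[s1 s2] := sW w; rewrite ger0_norm ?subr_ge0//; lra.
have i1 : P.-integrable setT (EFin \o (fun w => (W w - s w) * Y w)).
  by apply: integrable_bounded_mul sb iY; exact: measurable_funB.
have i2 : P.-integrable setT (EFin \o (fun w => s w * Y w)).
  apply: (@integrable_bounded_mul _ _ (c + n%:R^-1)) => // w.
  have /andP[s1 s2] := sW w; have /andP[w0 w1] := Wc w.
  have nn : 0 <= n%:R^-1 :> R by rewrite invr_ge0.
  by rewrite ler_norml; apply/andP; split; lra.
have -> : \int[P]_w (W w * Y w) = \int[P]_w ((W w - s w) * Y w).
  rewrite -[RHS]addr0 -sY0 -RintegralD//.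
  by apply: eq_Rintegral => w _; rewrite -mulrDl subrK.
apply: le_trans (le_normr_Rintegral _ i1) _ => //.
have iYn := integrable_norm iY.
rewrite -RintegralZl//; apply: le_Rintegral => //.
- exact: integrable_norm i1.
- exact: (integrableZl _ n%:R^-1 iYn).
- by move=> w _ /=; rewrite normrM ler_wpM2r.
Qed.

Lemma adapted_pull_out F W Y Y' c : F `<=` measurable -> adapted F W ->
  (forall w, `|W w| <= c) ->
  P.-integrable setT (EFin \o Y) -> P.-integrable setT (EFin \o Y') ->
  (forall A, <<s F >> A -> \int[P]_(w in A) Y w = \int[P]_(w in A) Y' w) ->
  \int[P]_w (W w * Y w) = \int[P]_w (W w * Y' w).
Proof.
move=> sF aW Wc iY iY' YY'.
have mW := adapted_measurable sF aW.
have sF' : <<s F >> `<=` measurable.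
  by apply: smallest_sub => //; exact: sigma_algebra_measurable.
have iB : P.-integrable setT (EFin \o (fun w => Y w - Y' w)).
  exact: (integrableB _ iY iY').
have B0 A : <<s F >> A -> \int[P]_(w in A) (Y w - Y' w) = 0.
  move=> FA; have mA := sF' _ FA.
  by rewrite RintegralB ?YY' ?subrr//; exact: integrableS measurableT mA _ _.
have H : \int[P]_w ((W w + c) * (Y w - Y' w)) = 0.
  apply: (@adapted_orthogonal F _ _ (c + c)) => //.
    by apply: measurable_funD => //; exact: measurable_cst.
  by move=> w; have := Wc w; rewrite ler_norml => /andP[? ?]; apply/andP; split; lra.
have iWB : P.-integrable setT (EFin \o (fun w => W w * (Y w - Y' w))).
  exact: integrable_bounded_mul Wc iB.
have {H} : \int[P]_w (W w * (Y w - Y' w)) + c * \int[P]_w (Y w - Y' w) = 0.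
  rewrite -H -RintegralZl// -RintegralD//; last exact: (integrableZl _ c iB).
  by apply: eq_Rintegral => w _; rewrite mulrDl.
have FT : <<s F >> [set: Omega] := @measurableT _ (g_sigma_algebraType F).
rewrite B0//.
rewrite mulr0 addr0 => H; apply/eqP; rewrite -subr_eq0 -RintegralB//; first last.
- exact: integrable_bounded_mul Wc iY'.
- exact: integrable_bounded_mul Wc iY.
by rewrite -[X in _ == X]H; apply/eqP; apply: eq_Rintegral => w _; rewrite mulrBr.
Qed.

Lemma adapted_dotp_mean (d : nat) F (a m y : Omega -> 'rV[R]_d) c :
  F `<=` measurable -> (forall i, adapted F (fun w => y w 0 i)) ->
  (forall i w, `|y w 0 i| <= c) ->
  (forall i, P.-integrable setT (EFin \o (fun w => a w 0 i))) ->
  (forall i, P.-integrable setT (EFin \o (fun w => m w 0 i))) ->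
  (forall i A, <<s F >> A -> \int[P]_(w in A) a w 0 i = \int[P]_(w in A) m w 0 i) ->
  forall A, <<s F >> A ->
    \int[P]_(w in A) dotp (a w) (y w) = \int[P]_(w in A) dotp (m w) (y w).
Proof.
move=> sF ay yc ia im am A FA; rewrite Rintegral_mkcond [RHS]Rintegral_mkcond.
pose W i w : R := \1_A w * y w 0 i.
have aW i : adapted F (W i).
  apply: measurable_funM; last exact: ay.
  exact: (@measurable_indic _ (g_sigma_algebraType F) R setT A FA).
have Wc i w : `|W i w| <= c.
  apply: le_trans (yc i w); rewrite normrM indicE.
  by case: (_ \in _); rewrite ?normr1 ?normr0 ?mul1r ?mul0r.
have E (h : Omega -> 'rV[R]_d) : (forall i, P.-integrable setT (EFin \o (fun w => h w 0 i))) ->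
    \int[P]_w ((fun w => dotp (h w) (y w)) \_ A) w = \sum_i \int[P]_w (W i w * h w 0 i).
  move=> ih; have iW i := integrable_bounded_mul (adapted_measurable sF (aW i)) (Wc i) (ih i).
  have [_ <-] := Rintegral_sum (index_enum 'I_d) iW.
  apply: eq_Rintegral => w _; rewrite patchE /W indicE /dotp.
  case: ifPn => _; last by rewrite big1// => i _; rewrite !mul0r.
  by apply: eq_bigr => i _; rewrite mul1r mulrC.
rewrite !E//; apply: eq_bigr => i _.
exact: adapted_pull_out sF (aW i) (Wc i) (ia i) (im i) (am i).
Qed.

End SubSigmaAlgebra.

Section ExpQuadratic.
Context {R : realType}.

Let taylor (c x : R) := (1 + x + x ^+ 2 / 2 + c * x ^+ 3) * expR (- x).

Let taylor_derive (c x : R) : is_derive x 1 (taylor c)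
  (((3 * c - 2^-1) * x ^+ 2 - c * x ^+ 3) * expR (- x)).
Proof.
rewrite /taylor; apply: is_derive_eq.
by rewrite /GRing.scale /= !mulr0; field.
Qed.

Let taylor_continuous c : continuous (taylor c).
Proof.
move=> x; apply: differentiable_continuous; apply/derivable1_diffP.
by have := taylor_derive c x.
Qed.

(** The quotient of a Taylor polynomial by the exponential is monotone on each side
of the origin. *)
Lemma expR_le_quadratic (y : R) : `|y| <= 1 ->
  expR y <= 1 + y + (1 + `|y|) * y ^+ 2 / 2.
Proof.
have mvt (c a b : R) : a <= b -> exists2 x, x \in `[a, b]%R & taylor c b - taylor c a =
    ((3 * c - 2^-1) * x ^+ 2 - c * x ^+ 3) * expR (- x) * (b - a).
  move=> ab; apply: (@MVT_segment R (taylor c)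
    (fun x => ((3 * c - 2^-1) * x ^+ 2 - c * x ^+ 3) * expR (- x)) a b ab) => [x _|].
    exact: taylor_derive.
  exact: continuous_subspaceT (@taylor_continuous c).
have taylor0 c : taylor c 0 = 1 by rewrite /taylor oppr0 expR0; lra.
have concl c : 1 <= taylor c y -> expR y <= 1 + y + y ^+ 2 / 2 + c * y ^+ 3.
  by rewrite /taylor expRN ler_pdivlMr ?expR_gt0// mul1r.
have [y0|y0] := leP 0 y.
  rewrite (ger0_norm y0) => y1.
  have [x] := mvt 2^-1 0 y y0; rewrite in_itv /= taylor0 => /andP[x0 xy] E.
  have : 1 <= taylor 2^-1 y.
    rewrite -subr_ge0 E mulr_ge0 ?subr_ge0// mulr_ge0 ?expR_ge0//.
    have x1 : x <= 1 by exact: le_trans y1.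
    have := sqr_ge0 x; nra.
  by move/concl; lra.
rewrite (ltr0_norm y0) => y1.
have [x] := mvt 0 y 0 (ltW y0); rewrite in_itv /= taylor0 => /andP[yx x0] E.
have : 1 <= taylor 0 y.
  rewrite -subr_le0 E pmulr_lle0 ?subr_gt0// pmulr_lle0 ?expR_gt0//.
  by have := sqr_ge0 x; lra.
move/concl => /le_trans; apply.
have : 0 <= - y * y ^+ 2 by rewrite mulr_ge0 ?sqr_ge0// oppr_ge0 ltW.
lra.
Qed.

End ExpQuadratic.

Section ExpSupermartingale.
Context {R : realType} {dO : measure_display} {Omega : measurableType dO}.
Variable P : probability Omega R.
Variables (F : nat -> set (set Omega)) (x c kap : nat -> Omega -> R) (b : R).
Hypothesis F_sub : forall k, F k `<=` measurable.
Hypothesis F_mono : forall k, F k `<=` F k.+1.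
Hypothesis x_adapted : forall k, adapted (F k.+1) (x k).
Hypothesis c_adapted : forall k, adapted (F k) (c k).
Hypothesis kap_adapted : forall k, adapted (F k) (kap k).
Hypothesis x_bounded : forall k w, `|x k w| <= b.
Hypothesis c_bounded : forall k w, `|c k w| <= b.
Hypothesis kap_bounded : forall k w, `|kap k w| <= b.
Hypothesis exp_le : forall k w, expR (x k w) <= 1 + x k w + kap k w.
Hypothesis mean : forall k A, <<s F k >> A ->
  \int[P]_(w in A) x k w = \int[P]_(w in A) c k w.

(** The logarithm of the product of the factors [expR (x j)], each compensated by its
conditional mean [c j] and by the budget [kap j] for its second-order part. *)
Definition log_martingale k w := \sum_(j < k) (x j w - c j w - kap j w).

Lemma log_martingale_adapted k : adapted (F k) (log_martingale k).
Proof.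
elim: k => [|k IH].
  by rewrite /log_martingale; under eq_fun do rewrite big_ord0; exact: measurable_cst.
rewrite /adapted /log_martingale; under eq_fun do rewrite big_ord_recr.
have up (h : Omega -> R) : adapted (F k) h -> adapted (F k.+1) h.
  by apply: adapted_sub => A /F_mono FA; exact: sub_sigma_algebra.
apply: measurable_funD; first exact: up IH.
apply: measurable_funB; last exact: up (@kap_adapted k).
by apply: measurable_funB; [exact: (@x_adapted k)|exact: up (@c_adapted k)].
Qed.

Lemma log_martingale_bounded k w : `|log_martingale k w| <= 3 * b *+ k.
Proof.
elim: k => [|k IH]; first by rewrite /log_martingale big_ord0 normr0 mulr0n.
rewrite /log_martingale big_ord_recr mulrSr; apply: le_trans (ler_normD _ _) _.
apply: lerD => //; apply: le_trans (ler_normB _ _) _.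
have := ler_normB (x k w) (c k w); have := x_bounded k w; have := c_bounded k w.
have := kap_bounded k w; move=> /=; lra.
Qed.

Let bounded_exp (h : Omega -> R) (M : R) : (forall w, `|h w| <= M) ->
  forall w, `|expR (h w)| <= expR M.
Proof. by move=> hM w; rewrite ger0_norm ?expR_ge0// ler_expR (le_trans (ler_norm _)). Qed.

(** Conditionally on [F k], the factor [expR (x k)] is at most [1 + x k + kap k], whose
mean [1 + c k + kap k] is below [expR (c k + kap k)]: the compensated product decreases
in mean. *)
Lemma exp_supermartingale k : \int[P]_w expR (log_martingale k w) <= 1.
Proof.
elim: k => [|k IH].
  under eq_Rintegral do rewrite /log_martingale big_ord0 expR0.
  by rewrite Rintegral_cst// (congr1 fine (probability_setT P)) mulr1.
apply: le_trans IH.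
have mes (F0 : set (set Omega)) (h : Omega -> R) : F0 `<=` measurable -> adapted F0 h -> measurable_fun setT h.
  exact: adapted_measurable.
pose W w := expR (log_martingale k w - c k w - kap k w).
have aW : adapted (F k) W.
  apply: measurableT_comp; first exact: measurable_expR.
  apply: measurable_funB; last exact: kap_adapted.
  by apply: measurable_funB; [exact: log_martingale_adapted|exact: c_adapted].
have bL w : `|log_martingale k w - c k w - kap k w| <= 3 * b *+ k + b + b.
  apply: le_trans (ler_normB _ _) _; apply: lerD => //.
  by apply: le_trans (ler_normB _ _) _; apply: lerD => //; exact: log_martingale_bounded.
have bW := bounded_exp bL; rewrite -/W in bW.
have mW := mes _ _ (@F_sub k) aW.
have ix : P.-integrable setT (EFin \o x k).
  by apply: bounded_integrable (x_bounded k); exact: mes (@F_sub k.+1) (@x_adapted k).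
have ic : P.-integrable setT (EFin \o c k).
  by apply: bounded_integrable (c_bounded k); exact: mes (@F_sub k) (@c_adapted k).
have ikap : P.-integrable setT (EFin \o kap k).
  by apply: bounded_integrable (kap_bounded k); exact: mes (@F_sub k) (@kap_adapted k).
have iM j : P.-integrable setT (EFin \o (fun w => expR (log_martingale j w))).
  apply: bounded_integrable (bounded_exp (log_martingale_bounded j)).
  apply: measurableT_comp; first exact: measurable_expR.
  exact: mes (@F_sub j) (@log_martingale_adapted j).
have iW : P.-integrable setT (EFin \o W) by exact: bounded_integrable bW.
have mulW Y : P.-integrable setT (EFin \o Y) ->
    P.-integrable setT (EFin \o (fun w => W w * Y w)).
  by move=> iY; exact: integrable_bounded_mul bW iY.
have add (Y Z : Omega -> R) : P.-integrable setT (EFin \o Y) ->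
    P.-integrable setT (EFin \o Z) -> P.-integrable setT (EFin \o (fun w => Y w + Z w)).
  by move=> iY iZ; exact: (integrableD _ iY iZ).
have W0 w : 0 <= W w by exact: expR_ge0.
have iWk : P.-integrable setT (EFin \o (fun w => W w + W w * kap k w)).
  exact: add _ _ iW (mulW _ ikap).
have split3 (Y : Omega -> R) : P.-integrable setT (EFin \o Y) ->
    \int[P]_w (W w + W w * kap k w + W w * Y w) =
    \int[P]_w (W w + W w * kap k w) + \int[P]_w (W w * Y w).
  by move=> iY; rewrite RintegralD//; exact: mulW.
apply: (@le_trans _ _ (\int[P]_w (W w + W w * kap k w + W w * x k w))).
  apply: le_Rintegral => //; first exact: add _ _ iWk (mulW _ ix).
  move=> w _.
  have -> : expR (log_martingale k.+1 w) = W w * expR (x k w).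
    by rewrite /W -expRD /log_martingale big_ord_recr /=; congr expR; ring.
  by have := ler_wpM2l (W0 w) (exp_le k w); lra.
rewrite split3// (@adapted_pull_out _ _ _ P (F k) W (x k) (c k) _ (@F_sub k) aW bW)//;
  last exact: mean.
rewrite -split3//; apply: le_Rintegral => //.
  exact: add _ _ iWk (mulW _ ic).
move=> w _.
have -> : expR (log_martingale k w) = W w * expR (c k w + kap k w).
  by rewrite /W -expRD; congr expR; ring.
by have := ler_wpM2l (W0 w) (expR_ge1Dx (c k w + kap k w)); lra.
Qed.

(** Markov's inequality for the exponential. *)
Lemma exp_supermartingale_tail k (delta : R) : 0 < delta ->
  (P [set w | (ln delta^-1 < log_martingale k w)%R] <= delta%:E)%E.
Proof.
move=> d0; set A := [set w | _].
have mL := adapted_measurable (@F_sub k) (@log_martingale_adapted k).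
have mA : measurable A.
  have -> : A = log_martingale k @^-1` `]ln delta^-1, +oo[%classic.
    by apply/seteqP; split=> w /=; rewrite in_itv/= andbT.
  by rewrite -[X in measurable X]setTI; exact: mL.
have iA : P.-integrable setT (EFin \o (fun w => delta^-1 * \1_A w)).
  exact: (integrableZl _ delta^-1 (integrable_indic P mA)).
have : \int[P]_w (delta^-1 * \1_A w) <= 1.
  apply: le_trans (exp_supermartingale k); apply: le_Rintegral => //.
    apply: bounded_integrable (bounded_exp (log_martingale_bounded k)).
    by apply: measurableT_comp; first exact: measurable_expR.
  move=> w _; rewrite indicE; case: (boolP (w \in A)) => [|_]; last by rewrite mulr0 expR_ge0.
  rewrite inE /= mulr1 => /ltW; rewrite -ler_expR lnK// posrE invr_gt0//.
rewrite RintegralZl//; last exact: integrable_indic.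
rewrite /Rintegral integral_indic// setIT mulrC ler_pdivrMr// mul1r => H.
by rewrite -[P A]fineK ?lee_fin// fin_num_measure.
Qed.

End ExpSupermartingale.

(** * Measurability of random vectors *)

Section VectorMeasurability.
Context {R : realType} {d : nat}.
Local Notation V := 'rV[R]_d.
Local Notation borelV := (g_sigma_algebraType (@open V)).

Lemma continuous_measurable_real (h : V -> R) : continuous h ->
  measurable_fun [set: borelV] (h : borelV -> R).
Proof.
move=> ch; apply: (measurability (@RGenOpens.G R)); first exact: RGenOpens.measurableE.
move=> _ [_ [a [b ->]] <-]; rewrite setTI; apply: sub_sigma_algebra.
by apply: open_comp; [move=> ? _; exact: ch|exact: interval_open].
Qed.

Lemma continuous_measurable_vector (h : V -> V) : continuous h ->
  measurable_fun [set: borelV] (h : borelV -> borelV).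
Proof.
move=> ch; apply: (@measurability _ _ _ borelV _ _ (@open V)) => //.
move=> _ [A oA <-]; rewrite setTI; apply: sub_sigma_algebra.
by apply: open_comp => // ? _; exact: ch.
Qed.

Lemma closed_borel (A : set V) : closed A -> measurable (A : set borelV).
Proof.
move=> cA; rewrite -[A]setCK; apply: measurableC; apply: sub_sigma_algebra.
exact: closed_openC.
Qed.

Section Source.
Context {d0 : measure_display} {T0 : measurableType d0}.
Implicit Types X Y : T0 -> V.

Lemma measurable_coord X i : measurable_fun [set: T0] (X : T0 -> borelV) ->
  measurable_fun [set: T0] (fun w => X w 0 i).
Proof.
move=> mX.
exact: measurableT_comp (continuous_measurable_real (@coord_continuousV R d i)) mX.
Qed.

(** Every open set is a countable union of boxes with rational data, and a box is a
finite intersection of events about single coordinates. *)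
Lemma measurable_vector X : (forall i, measurable_fun [set: T0] (fun w => X w 0 i)) ->
  measurable_fun [set: T0] (X : T0 -> borelV).
Proof.
move=> mX; apply: (@measurability _ _ _ borelV _ _ (@open V)) => //.
move=> _ [A oA <-]; rewrite setTI.
pose box (q : 'rV[rat]_d * nat) : set V :=
  [set y | forall i, `|y 0 i - ratr (q.1 0 i)| < q.2.+1%:R^-1].
pose F q := if `[< box q `<=` A >] then X @^-1` box q else set0.
have -> : X @^-1` A = \bigcup_q F q.
  apply/seteqP; split=> [w /= Aw|w [q _]]; last first.
    by rewrite /F; case: asboolP => // qA /qA.
  have /nbhs_normP[e /= e0 He] : nbhs (X w) A by exact: open_nbhs_nbhs.
  pose n := Num.truncn (2 / e).
  have n0 : 0 < n.+1%:R^-1 :> R by rewrite invr_gt0.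
  have ne : 2 * n.+1%:R^-1 < e.
    by rewrite -ltr_pdivlMr ?invr_gt0// invrK mulrC -ltr_pdivrMr// truncnS_gt.
  have near_rat i : exists q : rat, `|X w 0 i - ratr q| < n.+1%:R^-1.
    have lt : X w 0 i - n.+1%:R^-1 < X w 0 i + n.+1%:R^-1.
      by rewrite ltrBlDr -addrA ltrDl addr_gt0.
    have [q] := rat_in_itvoo lt; rewrite in_itv /= => /andP[q1 q2]; exists q.
    by rewrite distrC ltr_distl q1 q2.
  pose q := \row_i xget 0 [set q : rat | `|X w 0 i - ratr q| < n.+1%:R^-1].
  have qP i : `|X w 0 i - ratr (q 0 i)| < n.+1%:R^-1.
    by rewrite mxE; exact: (xgetPex 0 (near_rat i)).
  exists (q, n) => //; rewrite /F; case: asboolP => [//|]; case=> y /= yq; apply: He.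
  apply: le_lt_trans ne; rewrite /= [leLHS]/Num.norm /= mx_normrE.
  apply/bigmax_leP; split; first by rewrite mulr_ge0// ltW.
  case=> a i _ /=; rewrite (ord1 a) !mxE -(subrKA (ratr (q 0 i))).
  apply: le_trans (ler_normD _ _) _.
  by rewrite mulr_natl mulr2n; apply: lerD; apply: ltW; rewrite ?qP// distrC; exact: yq.
apply: countable_bigcupT_measurable => [|q]; first exact: countableP.
rewrite /F; case: asboolP => // _.
have -> : X @^-1` box q =
    \bigcap_(i in [set: 'I_d]) [set w | `|X w 0 i - ratr (q.1 0 i)| < q.2.+1%:R^-1].
  by apply/seteqP; split=> w /= H i; [move=> _; exact: H|exact: (H i)].
apply: fin_bigcap_measurable; first exact: finite_finset.
move=> i _; have mb : measurable_fun [set: T0] (fun w => `|X w 0 i - ratr (q.1 0 i)|).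
  apply: measurableT_comp; first exact: normr_measurable.
  by apply: measurable_funB => //; exact: measurable_cst.
rewrite -[X in measurable X]setTI.
have := mb measurableT `]-oo, q.2.+1%:R^-1[%classic (measurable_itv _).
congr measurable; congr (_ `&` _); apply/seteqP; split=> w /=; by rewrite in_itv.
Qed.

Lemma measurable_dotp X Y : measurable_fun [set: T0] (X : T0 -> borelV) ->
  measurable_fun [set: T0] (Y : T0 -> borelV) ->
  measurable_fun [set: T0] (fun w => dotp (X w) (Y w)).
Proof.
move=> mX mY; apply: measurable_sum => i.
by apply: measurable_funM; exact: measurable_coord.
Qed.

Lemma measurable_addV X Y : measurable_fun [set: T0] (X : T0 -> borelV) ->
  measurable_fun [set: T0] (Y : T0 -> borelV) ->
  measurable_fun [set: T0] ((fun w => X w + Y w) : T0 -> borelV).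
Proof.
move=> mX mY; apply: measurable_vector => i; under eq_fun do rewrite mxE.
by apply: measurable_funD; exact: measurable_coord.
Qed.

Lemma measurable_scaleV (a : R) X : measurable_fun [set: T0] (X : T0 -> borelV) ->
  measurable_fun [set: T0] ((fun w => a *: X w) : T0 -> borelV).
Proof.
move=> mX; apply: measurable_vector => i; under eq_fun do rewrite mxE.
by apply: measurable_funM; [exact: measurable_cst|exact: measurable_coord].
Qed.

Lemma measurable_subV X Y : measurable_fun [set: T0] (X : T0 -> borelV) ->
  measurable_fun [set: T0] (Y : T0 -> borelV) ->
  measurable_fun [set: T0] ((fun w => X w - Y w) : T0 -> borelV).
Proof.
move=> mX mY; apply: measurable_vector => i; under eq_fun do rewrite !mxE.
by apply: measurable_funB; exact: measurable_coord.
Qed.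

End Source.
End VectorMeasurability.

(** * The noise of one inner run *)

Section Filtration.
Context {R : realType} {dO dX : measure_display} {Omega : measurableType dO}.
Context {Xi : measurableType dX}.
Variable xi : nat -> Omega -> Xi.
Hypothesis mxi : forall k, measurable_fun setT (xi k).

Lemma history_sigma k : <<s history xi k >> = history xi k.
Proof. by rewrite sigma_algebra_id//; exact: smallest_sigma_algebra. Qed.

Lemma history_measurable k : history xi k `<=` measurable.
Proof.
apply: smallest_sub; first exact: sigma_algebra_measurable.
by move=> A; rewrite -bigcup_seq => -[i _ [S mS <-]]; exact: mxi.
Qed.

Lemma history_le j k : (j <= k)%N -> history xi j `<=` history xi k.
Proof.
move=> jk; apply: smallest_sub; first exact: smallest_sigma_algebra.
move=> A; rewrite -bigcup_seq /= => -[i _ Ai]; apply: sub_sigma_algebra.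
rewrite -bigcup_seq /=; exists (widen_ord jk i) => //.
by rewrite /= mem_index_enum.
Qed.

Lemma sample_adapted k :
  measurable_fun [set: g_sigma_algebraType (history xi k.+1)] (xi k).
Proof.
move=> _ S mS; rewrite setTI; apply: sub_sigma_algebra; apply: sub_sigma_algebra.
rewrite -bigcup_seq /=; exists ord_max; first by rewrite /= mem_index_enum.
by exists S => //; rewrite setTI.
Qed.

End Filtration.

Section Noise.
Context {R : realType} {d : nat} {dO dX : measure_display}.
Context {Omega : measurableType dO} {Xi : measurableType dX}.
Local Notation V := 'rV[R]_d.
Local Notation borelV := (g_sigma_algebraType (@open V)).
Local Notation B := (unit_ball : set V).
Variables (l Gf Gg sigma : R) (f g : V -> R) (U : set V) (v : V -> V).
Hypothesis cp : constrained_problem l Gf Gg sigma f g U.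
Hypothesis vsub : forall x, unit_ball x -> limiting_subdiff f x (v x).
Variable K : nat.
Hypothesis K0 : (0 < K)%N.
Variables (P : probability Omega R) (xi : nat -> Omega -> Xi) (vt : V -> Xi -> V).
Hypothesis oracle : stochastic_oracle P xi B v Gf vt.
Implicit Types (X Y : Omega -> V) (k n j : nat).

Local Notation lam0 := (lambda0 l Gf sigma).
Local Notation p := (softplus lam0 K%:R^-1).
Local Notation H := (history xi).

Let mxi k : measurable_fun setT (xi k). Proof. by case: oracle. Qed.
Let gam_gt0 : 0 < K%:R^-1 :> R. Proof. by rewrite invr_gt0 ltr0n. Qed.
Let H_sub k : H k `<=` measurable. Proof. exact: history_measurable. Qed.

Definition vadapted k X :=
  measurable_fun [set: g_sigma_algebraType (H k)] (X : g_sigma_algebraType (H k) -> borelV).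

Lemma vadapted_le j k X : (j <= k)%N -> vadapted j X -> vadapted k X.
Proof.
move=> jk mX _ S mS; have := mX measurableT S mS; rewrite !setTI.
apply: smallest_sub; first exact: smallest_sigma_algebra.
by move=> A /(history_le jk) HA; exact: sub_sigma_algebra.
Qed.

Lemma vadapted_continuous k X (h : V -> V) : continuous h -> vadapted k X ->
  vadapted k (fun w => h (X w)).
Proof. by move=> ch; exact: measurableT_comp (continuous_measurable_vector ch). Qed.

Lemma vadapted_history k X S : vadapted k X -> open S -> H k (X @^-1` S).
Proof.
move=> mX oS; rewrite -history_sigma.
have mS : @measurable _ borelV S by exact: sub_sigma_algebra.
by have := mX measurableT S mS; rewrite setTI.
Qed.

Lemma answer_adapted k X : vadapted k X -> (forall w, B (X w)) ->
  vadapted k.+1 (fun w => vt (X w) (xi k w)).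
Proof.
move=> mX BX; apply: measurable_vector => i.
have [_ mvt _] := oracle.
have mpair : measurable_fun [set: g_sigma_algebraType (H k.+1)]
    ((fun w => (X w, xi k w)) : g_sigma_algebraType (H k.+1) -> (borelV * Xi)%type).
  apply: measurable_fun_pair; last exact: sample_adapted.
  exact: vadapted_le (leqnSn k) mX.
have mB : measurable (B `*` setT : set (borelV * Xi)%type).
  by apply: measurableX => //; apply: closed_borel; exact: closed_unit_ball.
apply: (measurable_comp mB _ (mvt i) mpair).
by move=> _ [w _ <-]; split => //=; exact: BX.
Qed.

Lemma mean_adapted k X i : vadapted k X -> (forall w, B (X w)) ->
  adapted (H k) (fun w => v (X w) 0 i).
Proof.
move=> mX BX; have [_ _ /(_ k X BX)] := oracle.
case=> [S oS|_ /(_ i) [_ _ Hm _]]; first exact: vadapted_history.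
by move=> _ S mS; rewrite setTI; apply: sub_sigma_algebra; exact: Hm.
Qed.

(** The oracle's bound only holds almost surely, whereas the exponentials of the
martingale argument have to be bounded: the answers are truncated. *)
Definition clip (a : V) : V := if enorm a <= Gf then a else 0.

Lemma clip_bound a : enorm (clip a) <= Gf.
Proof. by rewrite /clip; case: ifP => // _; rewrite enorm0 ltW// (cp_Gf cp). Qed.

Lemma vadapted_clip k X : vadapted k X -> vadapted k (fun w => clip (X w)).
Proof.
move=> mX; apply: measurable_vector => i.
have -> : (fun w => clip (X w) 0 i) = fun w => if enorm (X w) <= Gf then X w 0 i else 0.
  by apply/funext => w; rewrite /clip; case: ifP => // _; rewrite mxE.
apply: measurable_fun_ifT.
- apply: measurable_fun_ler; last exact: measurable_cst.
  exact: measurableT_comp (continuous_measurable_real (@enorm_continuous R d)) mX.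
- exact: measurable_coord.
- exact: measurable_cst.
Qed.

(** Truncation changes the answer only on a null set, so the conditional mean stays. *)
Lemma clip_mean k X i A : vadapted k X -> (forall w, B (X w)) -> <<s H k >> A ->
  \int[P]_(w in A) clip (vt (X w) (xi k w)) 0 i = \int[P]_(w in A) v (X w) 0 i.
Proof.
move=> mX BX; rewrite history_sigma => HA; have [_ _ /(_ k X BX)] := oracle.
case=> [S oS|bnd /(_ i) [ivt iv _ eqA]]; first exact: vadapted_history.
have mA := H_sub HA; rewrite /Rintegral -(eqA _ HA); congr fine.
apply: ae_eq_integral => //.
- apply/measurable_EFinP/measurable_funTS.
  apply: (adapted_measurable (@H_sub k.+1)); apply: measurable_coord.
  exact: vadapted_clip (answer_adapted mX BX).
- apply: measurable_funTS; exact: measurable_int ivt.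
- by apply: filterS bnd => w wG _; rewrite /clip wG.
Qed.

(** ** The run started at a random point *)

Variables (n0 : nat) (X0 : Omega -> V).
Hypothesis mX0 : vadapted n0 X0.
Hypothesis BX0 : forall w, B (X0 w).

Definition run j w := inner_iterate l g p (fun n z => vt z (xi n w)) n0 (X0 w) j.

Lemma run_step j w :
  run j.+1 w = psm_step l Gf sigma g K (X0 w) j.+1 (run j w) (vt (run j w) (xi (n0 + j) w)).
Proof. by []. Qed.

Lemma run_ball j w : B (run j w).
Proof. by case: j => [|j]; [exact: BX0|rewrite run_step; exact: psm_step_ball]. Qed.

Lemma nearest_ball_continuous : continuous (nearest B).
Proof.
exact: nearest_continuous closed_unit_ball (@subset_refl _ _) (ex_intro _ 0 unit_ball0)
  convex_unit_ball.
Qed.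

Lemma nearest_ball_in x : B (nearest B x).
Proof. exact: nearest_in closed_unit_ball (@subset_refl _ _) (ex_intro _ 0 unit_ball0) x. Qed.

Lemma nearest_ball_id x : B x -> nearest B x = x.
Proof. exact: nearest_id closed_unit_ball (@subset_refl _ _) (ex_intro _ 0 unit_ball0) x. Qed.

(** The gradient is only continuous near the ball; composing with the projection gives
a map that is continuous everywhere. *)
Lemma penalty_gradient_continuous :
  continuous (fun y : V => gradient (p \o g) (nearest B y)).
Proof.
have UB y : U (nearest B y) by apply: (cp_sub cp); exact: nearest_ball_in.
have -> : (fun y : V => gradient (p \o g) (nearest B y)) =
    fun y => softplus_slope lam0 K%:R^-1 (g (nearest B y)) *: gradient g (nearest B y).
  apply/funext => y; rewrite gradient_softplus_comp//; exact: (cp_gdiff cp (UB y)).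
move=> y; apply: (@cvgZ _ _ _ _ (nbhs_filter y)); last first.
  by apply: continuous_comp; [exact: nearest_ball_continuous|exact: (cp_gcont cp (UB y))].
apply: (@continuous_comp _ _ _ (fun y : V => g (nearest B y))); last first.
  exact: softplus_slope_continuous.
apply: continuous_comp; first exact: nearest_ball_continuous.
exact: differentiable_continuous (cp_gdiff cp (UB y)).
Qed.

Lemma run_adapted j : vadapted (n0 + j) (run j).
Proof.
elim: j => [|j IH]; first by rewrite addn0.
rewrite addnS; have up := vadapted_le (leqnSn (n0 + j)).
have mX0' : vadapted (n0 + j).+1 X0 by apply: vadapted_le mX0; rewrite leqW// leq_addr.
have mR := up _ IH.
have mA : vadapted (n0 + j).+1 (fun w => vt (run j w) (xi (n0 + j) w)).
  by apply: answer_adapted IH _ => w; exact: run_ball.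
have mG : vadapted (n0 + j).+1 (fun w => gradient (p \o g) (run j w)).
  have -> : (fun w => gradient (p \o g) (run j w)) =
      fun w => gradient (p \o g) (nearest B (run j w)).
    by apply/funext => w; rewrite nearest_ball_id//; exact: run_ball.
  exact: vadapted_continuous penalty_gradient_continuous mR.
have -> : run j.+1 = fun w => nearest B (run j w - (2 / (l * j.+2%:R)) *:
    (vt (run j w) (xi (n0 + j) w) + (2 * l) *: (run j w - X0 w) + gradient (p \o g) (run j w))) by [].
apply: vadapted_continuous; first exact: nearest_ball_continuous.
apply: measurable_subV => //; apply: measurable_scaleV; apply: measurable_addV => //.
by apply: measurable_addV => //; apply: measurable_scaleV; exact: measurable_subV.
Qed.

(** The comparison point of the regret, and the point towards which the noise is
measured. It is known before the run starts. *)
Definition target w := prox l f g (X0 w).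

Lemma target_ball w : B (target w).
Proof. by apply: (cp_ball cp); exact: (prox_feasible cp (BX0 w)). Qed.

Lemma prox_nearest_continuous : continuous (fun y : V => prox l f g (nearest B y)).
Proof.
move=> y; apply: (@lip_continuousV _ _ _ 2) => z.
apply: le_trans (prox_lip cp (nearest_ball_in z) (nearest_ball_in y)) _.
rewrite ler_pM2l//; apply: nearest_lip => //;
  [exact: closed_unit_ball|by exists 0; exact: unit_ball0|exact: convex_unit_ball].
Qed.

Lemma target_adapted j : vadapted (n0 + j) target.
Proof.
apply: vadapted_le (leq_addr j n0) _.
have -> : target = fun w => prox l f g (nearest B (X0 w)).
  by apply/funext => w; rewrite nearest_ball_id.
exact: vadapted_continuous prox_nearest_continuous mX0.
Qed.

Local Notation GHc := (GH l Gf Gg sigma).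
(** The exponent of the supermartingale. It makes [ln (1 / delta) / theta] the
quantile [2 GH ^ 2 / l * ln (1 / delta)] allowed for the noise. *)
Definition theta : R := l / (2 * GHc ^+ 2).
Definition answer j w := vt (run j w) (xi (n0 + j) w).
Definition offset j w := run j w - target w.

Let l0 := cp_l cp.
Let Gf0 := cp_Gf cp.

Lemma GH_lower : Gf + 4 * l <= GHc.
Proof.
rewrite /GH /GF lerDl mulr_ge0//; first exact: ltW (lambda0_gt0 cp).
exact: ltW (cp_Gg cp).
Qed.

Lemma theta_gt0 : 0 < theta.
Proof.
have GHp : 0 < GHc by apply: lt_le_trans GH_lower; have := l0; have := Gf0; lra.
by rewrite divr_gt0// mulr_gt0// exprn_gt0.
Qed.

Lemma offset_bound j w : enorm (offset j w) <= 2.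
Proof. by apply: enormB_unit_ball; [exact: run_ball|exact: target_ball]. Qed.

Lemma offset_adapted j : vadapted (n0 + j) (offset j).
Proof. by apply: measurable_subV; [exact: run_adapted|exact: target_adapted]. Qed.

Definition noise j w := dotp (clip (answer j w)) (- theta *: offset j w).
Definition drift j w := dotp (v (run j w)) (- theta *: offset j w).
Definition budget j w := theta * (l / 4 * enorm (offset j w) ^+ 2).

(** The gap between [Gf] and [GH] pays for the cubic term of the exponential: with
[s = 2 theta Gf = l Gf / GH ^ 2] one has [(1 + s) Gf ^ 2 <= Gf ^ 2 + l Gf <= GH ^ 2]. *)
Lemma expR_noise_le j w : expR (noise j w) <= 1 + noise j w + budget j w.
Proof.
have th0 := theta_gt0; have GH1 := GH_lower; have l1 := l0; have G1 := Gf0.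
set y := noise j w; set E := enorm (offset j w).
have E0 : 0 <= E by exact: enorm_ge0.
have E2 : E <= 2 by exact: offset_bound.
have yE : `|y| <= theta * Gf * E.
  apply: le_trans (normr_dotp_le _ _) _; rewrite enormZ normrN gtr0_norm// -/E.
  by rewrite mulrCA mulrA ler_wpM2r// ler_wpM2l ?(ltW th0)// clip_bound.
have GHp : 0 < GHc by lra.
have thE : theta * (2 * GHc ^+ 2) = l.
  by rewrite /theta divfK// mulf_neq0// ?expf_neq0// gt_eqF.
have s0 : 0 <= theta * Gf by rewrite mulr_ge0// ltW.
have GH2 : Gf ^+ 2 + 8 * l * Gf <= GHc ^+ 2 by nra.
(* [s GH ^ 2 = l Gf] *)
have s1 : 2 * (theta * Gf) * GHc ^+ 2 = l * Gf by rewrite -[in RHS]thE; ring.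
have GHp2 : 0 < GHc ^+ 2 by rewrite exprn_gt0.
have lG : 0 < l * Gf by rewrite mulr_gt0.
have s2 : 2 * (theta * Gf) <= 1.
  by rewrite -(ler_pM2r GHp2) s1 mul1r; have := sqr_ge0 Gf; lra.
have s3 : 2 * (theta * Gf) * Gf ^+ 2 <= l * Gf.
  rewrite -s1 ler_wpM2l//; first by rewrite mulr_ge0.
  by lra.
have key : (1 + 2 * (theta * Gf)) * (theta * Gf ^+ 2) <= l / 2.
  have : theta * ((1 + 2 * (theta * Gf)) * Gf ^+ 2) <= theta * GHc ^+ 2.
    by rewrite ler_pM2l//; lra.
  by lra.
have y2 : `|y| <= 2 * (theta * Gf).
  by apply: le_trans yE _; rewrite mulrC ler_wpM2r.
apply: le_trans (expR_le_quadratic (le_trans y2 s2)) _.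
rewrite lerD2l /budget -/E.
have ysq : y ^+ 2 <= (theta * Gf * E) ^+ 2.
  by rewrite -real_normK ?num_real// ler_sqr ?nnegrE// (le_trans (normr_ge0 y)).
apply: (@le_trans _ _ ((1 + 2 * (theta * Gf)) * (theta * Gf * E) ^+ 2 / 2)).
  by rewrite ler_wpM2r ?invr_ge0// ler_pM ?sqr_ge0 ?lerD2l// addr_ge0.
have : theta * E ^+ 2 * ((1 + 2 * (theta * Gf)) * (theta * Gf ^+ 2)) <= theta * E ^+ 2 * (l / 2).
  by rewrite ler_wpM2l// mulr_ge0 ?sqr_ge0// ltW.
lra.
Qed.

Let bnd := 2 * theta * Gf + theta * l.

Let dotp_offset_bound a j w : enorm a <= Gf -> `|dotp a (- theta *: offset j w)| <= bnd.
Proof.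
move=> aG; apply: le_trans (normr_dotp_le _ _) _.
have th0 := theta_gt0; rewrite enormZ normrN gtr0_norm//.
apply: (@le_trans _ _ (Gf * (theta * 2))).
  apply: ler_pM => //; first exact: enorm_ge0.
    by apply: mulr_ge0; [exact: ltW|exact: enorm_ge0].
  by rewrite (ler_pM2l th0) offset_bound.
by rewrite /bnd; have := mulr_gt0 th0 l0; lra.
Qed.

Let budget_bound j w : `|budget j w| <= bnd.
Proof.
have th0 := theta_gt0; have E0 := enorm_ge0 (offset j w); have E2 := offset_bound j w.
have b0 : 0 <= l / 4 * enorm (offset j w) ^+ 2.
  by rewrite mulr_ge0 ?sqr_ge0// divr_ge0// ltW// l0.
rewrite ger0_norm; last by rewrite mulr_ge0// ltW.
apply: (@le_trans _ _ (theta * l)); last first.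
  by rewrite /bnd lerDr mulr_ge0 ?(ltW Gf0)// mulr_ge0// ltW.
rewrite ler_pM2l//; have E4 : enorm (offset j w) ^+ 2 <= 4 by nra.
by have := ler_wpM2l (ltW l0) E4; lra.
Qed.

Let scaled_adapted j : vadapted (n0 + j) (fun w => - theta *: offset j w).
Proof. by apply: measurable_scaleV; exact: offset_adapted. Qed.

Let answer_clip_adapted j : vadapted (n0 + j).+1 (fun w => clip (answer j w)).
Proof. by apply: vadapted_clip; apply: answer_adapted (@run_adapted j) _ => w; exact: run_ball. Qed.

Let mean_run_adapted j : vadapted (n0 + j) (fun w => v (run j w)).
Proof.
by apply: measurable_vector => i; apply: mean_adapted (@run_adapted j) _ => w; exact: run_ball.
Qed.

Let noise_adapted j : adapted (H (n0 + j.+1)) (noise j).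
Proof.
rewrite addnS; apply: measurable_dotp; first exact: answer_clip_adapted.
exact: vadapted_le (leqnSn _) (@scaled_adapted j).
Qed.

Let drift_adapted j : adapted (H (n0 + j)) (drift j).
Proof. by apply: measurable_dotp; [exact: mean_run_adapted|exact: scaled_adapted]. Qed.

Let budget_adapted j : adapted (H (n0 + j)) (budget j).
Proof.
apply: measurable_funM; first exact: measurable_cst.
apply: measurable_funM; first exact: measurable_cst.
apply: measurable_funX.
exact: measurableT_comp (continuous_measurable_real (@enorm_continuous R d)) (@offset_adapted j).
Qed.

Let noise_mean j A : <<s H (n0 + j) >> A ->
  \int[P]_(w in A) noise j w = \int[P]_(w in A) drift j w.
Proof.
have bounded_coord (h : Omega -> V) i : measurable_fun setT (fun w => h w 0 i) ->
    (forall w, enorm (h w) <= Gf) -> P.-integrable setT (EFin \o (fun w => h w 0 i)).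
  move=> mh hG; apply: bounded_integrable mh _ => w.
  exact: le_trans (coord_le_enorm _ _) (hG w).
apply: (adapted_dotp_mean (@H_sub (n0 + j)) (c := 2 * theta)).
- by move=> i; apply: measurable_coord; exact: scaled_adapted.
- move=> i w; apply: le_trans (coord_le_enorm _ _) _.
  have th0 := theta_gt0; rewrite enormZ normrN gtr0_norm// mulrC.
  by rewrite ler_wpM2r ?(ltW th0)// offset_bound.
- move=> i; apply: bounded_coord => [|w]; last exact: clip_bound.
  apply: (adapted_measurable (@H_sub (n0 + j).+1)); apply: measurable_coord.
  exact: answer_clip_adapted.
- move=> i; apply: bounded_coord => [|w].
    apply: (adapted_measurable (@H_sub (n0 + j))); apply: measurable_coord.
    exact: mean_run_adapted.
  by apply: (oracle_mean_bound cp vsub); exact: run_ball.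
- move=> i A' HA'; apply: clip_mean HA'; first exact: run_adapted.
  by move=> w; exact: run_ball.
Qed.

(** The noise term of the regret bound, for truncated answers. Scaled by [theta], its
surplus [- l / 4] times the squared offset is the budget of the supermartingale. *)
Definition total_noise w := \sum_(j < K)
  (dotp (v (run j w) - clip (answer j w)) (offset j w) - l / 4 * enorm (offset j w) ^+ 2).

Let log_total w : log_martingale noise drift budget K w = theta * total_noise w.
Proof.
rewrite /log_martingale /total_noise mulr_sumr; apply: eq_bigr => j _.
by rewrite /noise /drift /budget !dotpZr dotpDl dotpNl; ring.
Qed.

Let threshold (delta : R) : ln delta^-1 = theta * (2 * GHc ^+ 2 / l * ln delta^-1).
Proof.
have GHp : 0 < GHc by apply: lt_le_trans GH_lower; have := l0; have := Gf0; lra.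
by rewrite /theta; field; rewrite !gt_eqF.
Qed.

Lemma total_noise_tail (delta : R) : 0 < delta ->
  (P [set w | (2 * GHc ^+ 2 / l * ln delta^-1 < total_noise w)%R] <= delta%:E)%E.
Proof.
move=> d0.
have mono k : H (n0 + k) `<=` H (n0 + k.+1) by apply: history_le; rewrite addnS.
have := exp_supermartingale_tail (F := fun k => H (n0 + k)) (fun k => @H_sub (n0 + k)) mono
  noise_adapted drift_adapted budget_adapted
  (fun j w => dotp_offset_bound j w (clip_bound _)) 
  (fun j w => dotp_offset_bound j w (oracle_mean_bound cp vsub (run_ball j w)))
  budget_bound expR_noise_le noise_mean K d0.
have E w : (ln delta^-1 < log_martingale noise drift budget K w) =
    (2 * GHc ^+ 2 / l * ln delta^-1 < total_noise w).
  by rewrite log_total [in LHS]threshold ltr_pM2l// theta_gt0.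
by under eq_fun do rewrite E.
Qed.

Lemma total_noise_adapted : adapted (H (n0 + K)) total_noise.
Proof.
have -> : total_noise = fun w => theta^-1 * log_martingale noise drift budget K w.
  by apply/funext => w; rewrite log_total mulKf// gt_eqF// theta_gt0.
apply: measurable_funM; first exact: measurable_cst.
apply: (log_martingale_adapted (F := fun k => H (n0 + k))) => //.
by move=> k; apply: history_le; rewrite addnS.
Qed.

(** The event on which the run behaves: the oracle respects its bound and the noise does
not exceed its quantile. *)
Definition good_run (delta : R) : set Omega :=
  [set w | (forall j : 'I_K, enorm (answer j w) <= Gf) /\
    total_noise w <= 2 * GHc ^+ 2 / l * ln delta^-1].

Lemma good_run_history delta : H (n0 + K) (good_run delta).
Proof.
rewrite -history_sigma.
have -> : good_run delta =
    (\bigcap_(j in [set: 'I_K]) [set w | enorm (answer j w) <= Gf]) `&`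
    [set w | total_noise w <= 2 * GHc ^+ 2 / l * ln delta^-1].
  by apply/seteqP; split=> w [w1 w2]; split=> // j; [move=> _; exact: w1|exact: (w1 j)].
have le_set (h : Omega -> R) c : adapted (H (n0 + K)) h ->
    @measurable _ (g_sigma_algebraType (H (n0 + K))) [set w | h w <= c].
  move=> ah; have := ah measurableT `]-oo, c]%classic (measurable_itv _).
  by rewrite setTI; congr measurable; apply/seteqP; split=> w /=; rewrite in_itv.
apply: (@measurableI _ (g_sigma_algebraType (H (n0 + K)))); last exact: le_set total_noise_adapted.
apply: (@fin_bigcap_measurable _ (g_sigma_algebraType (H (n0 + K)))); first exact: finite_finset.
move=> j _; apply: le_set.
apply: measurableT_comp (continuous_measurable_real (@enorm_continuous R d)) _.
apply: (@vadapted_le (n0 + j).+1); first by rewrite -addnS leq_add2l.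
by apply: answer_adapted (@run_adapted j) _ => w; exact: run_ball.
Qed.

Lemma good_run_prob (delta : R) : 0 < delta -> (P (~` good_run delta) <= delta%:E)%E.
Proof.
move=> d0; set c := 2 * GHc ^+ 2 / l * ln delta^-1.
pose A := [set w | c < total_noise w].
have mG : measurable (good_run delta) by exact: H_sub (good_run_history delta).
have mA : measurable A.
  have mN := adapted_measurable (@H_sub _) total_noise_adapted.
  have := mN measurableT `]c, +oo[%classic (measurable_itv _).
  by rewrite setTI; congr measurable; apply/seteqP; split=> w /=; rewrite in_itv /= andbT.
have null : P (~` good_run delta `\` A) = 0.
  have ae_bound : {ae P, forall w, forall j : nat, enorm (answer j w) <= Gf}.
    apply: ae_foralln => j; have [_ _ /(_ (n0 + j) (run j)) []] := oracle => //.
    - by move=> w; exact: run_ball.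
    - by move=> S oS; apply: vadapted_history (@run_adapted j) oS.
  apply/(measure_negligible) => //; first by apply: measurableD => //; exact: measurableC.
  apply: negligibleS ae_bound => w [Gw Aw] aw; apply: Gw; split => [j|]; first exact: aw.
  by rewrite leNgt; apply/negP.
have sub : ~` good_run delta `<=` A `|` (~` good_run delta `\` A).
  by move=> w Gw; have [Aw|Aw] := pselect (A w); [left|right].
apply: le_trans (_ : P (A `|` (~` good_run delta `\` A)) <= _)%E.
  apply: le_measure => //; rewrite inE; first exact: measurableC.
  by apply: measurableU => //; apply: measurableD => //; exact: measurableC.
apply: le_trans (measureU2 _ _ _) _ => //.
  by apply: measurableD => //; exact: measurableC.
rewrite [X in (_ + X <= _)%E](_ : _ = 0%E); last exact: null.
by rewrite adde0; exact: total_noise_tail.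
Qed.

Definition run_output w := inner_output l g p K (fun n z => vt z (xi n w)) n0 (X0 w).

Lemma good_run_certificate (delta : R) w : good_run delta w ->
  penalized l Gf sigma f g (X0 w) (run_output w) <=
    penalized l Gf sigma f g (X0 w) (target w) + e_ K l Gf Gg sigma delta.
Proof.
move=> [bnd_w noise_w].
apply: (psm_certificate cp vsub K0 (a := fun j => answer j w) (BX0 w)) => //.
  by move=> j jK; exact: (bnd_w (Ordinal jK)).
move: noise_w; rewrite /total_noise; congr (_ <= _); apply: eq_bigr => j _.
by rewrite /clip bnd_w.
Qed.

Lemma run_output_ball w : B (run_output w).
Proof. by apply: average_unit_ball => // j _; exact: run_ball. Qed.

Lemma run_output_adapted : vadapted (n0 + K) run_output.
Proof.
apply: measurable_scaleV; apply: measurable_vector => i.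
under eq_fun do rewrite summxE.
apply: measurable_sum => j; apply: measurable_coord.
apply: vadapted_le (@run_adapted j).
by rewrite leq_add2l ltnW.
Qed.

End Noise.

(** * The outer loop *)

Section OuterLoop.
Context {R : realType} {d : nat}.
Local Notation V := 'rV[R]_d.
Variables (l Gf Gg sigma : R) (f g : V -> R) (U : set V).
Hypothesis cp : constrained_problem l Gf Gg sigma f g U.

Local Notation B := (unit_ball : set V).
Local Notation C := [set x : V | g x <= 0].
Local Notation gm y := (grad_mapping C f l (nearest C y)).

Let l0 : 0 < l := cp_l cp.

(** An inexact step whose projection is not [eps]-stationary must have started far from
its proximal point, and then it decreases the merit function by a fixed amount. With
[a] and [r] the distances of [z] and [x] to [prox x], the error bound gives
[l a <= eps / 40], and [eps < 3 l a + 2 l r] then forces [l r >= 37 eps / 80], which is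
enough for a decrease [l r ^ 2 / 2 >= eps ^ 2 / (10 l)]. *)
Lemma bad_step_decrease x z e eps : B x -> B z -> 0 < eps -> e <= eps ^+ 2 / (4000 * l) ->
  penalized l Gf sigma f g x z <= penalized l Gf sigma f g x (prox l f g x) + e ->
  merit l Gf sigma f g z + eps ^+ 2 / (10 * l) * (nat_of_bool (eps < gm z))%:R <=
    merit l Gf sigma f g x + e.
Proof.
move=> Bx Bz eps0 ee cert.
have desc := merit_descent cp Bx Bz cert.
have dist := prox_dist cp Bx Bz cert.
have gmz := grad_mapping_nearest cp Bx Bz.
rewrite (enormBC (prox l f g x) x) in gmz.
have a0 := enorm_ge0 (z - prox l f g x); have r0 := enorm_ge0 (x - prox l f g x).
move: (gm z) (merit l Gf sigma f g z) (merit l Gf sigma f g x) gmz desc dist a0 r0.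
move: (enorm (z - _)) (enorm (x - _)) => a r G mz mx gmz desc dist a0 r0.
have lr0 : 0 <= l / 2 * r ^+ 2 by rewrite mulr_ge0 ?sqr_ge0// divr_ge0// ltW.
have [bad|_] := ltP eps G; last by rewrite /= mulr0n mulr0 addr0; lra.
rewrite /= mulr1n mulr1.
have la : 40 * (l * a) <= eps.
  have H : l * (l * a ^+ 2) <= l * (2 * (eps ^+ 2 / (4000 * l))).
    by rewrite ler_pM2l//; lra.
  have E : l * (2 * (eps ^+ 2 / (4000 * l))) = eps ^+ 2 / 2000.
    by field; rewrite gt_eqF.
  have la0 : 0 <= 40 * (l * a) by rewrite !mulr_ge0// ltW.
  rewrite -ler_sqr ?nnegrE ?(ltW eps0)//.
  have := sqr_ge0 eps; move: H; rewrite E !exprMn; lra.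
have lr : 37 / 80 * eps <= l * r by lra.
have lr2 : (37 / 80 * eps) ^+ 2 <= (l * r) ^+ 2.
  by rewrite ler_sqr ?nnegrE// ?mulr_ge0// ltW.
have : eps ^+ 2 / (10 * l) <= l / 2 * r ^+ 2.
  rewrite ler_pdivrMr ?mulr_gt0//.
  have -> : l / 2 * r ^+ 2 * (10 * l) = 5 * (l * r) ^+ 2 by field.
  by have := sqr_ge0 eps; move: lr2; rewrite !exprMn; lra.
lra.
Qed.

(** The total decrease of the merit function is at most the initial gap, so most
iterates are good: at [eps ^ 2 / (10 l)] per bad step, the gap pays for T / 100 of them
and the errors for T / 400 more. *)
Lemma most_iterates_stationary (x : nat -> V) (T : nat) (Delta e eps : R) :
  0 < eps -> e <= eps ^+ 2 / (4000 * l) -> 1000 * l * Delta / eps ^+ 2 <= T%:R ->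
  C (x 0%N) -> (forall t, B (x t)) -> (forall z, B z -> f (x 0%N) - Delta <= f z) ->
  (forall t, (t < T)%N -> penalized l Gf sigma f g (x t) (x t.+1) <=
    penalized l Gf sigma f g (x t) (prox l f g (x t)) + e) ->
  4 / 5 * T%:R <= \sum_(t < T) (nat_of_bool (gm (x t.+1) <= eps))%:R :> R.
Proof.
move=> eps0 ee TD Cx0 Bx fmin cert.
have telescope n : (n <= T)%N -> merit l Gf sigma f g (x n) +
    eps ^+ 2 / (10 * l) * \sum_(t < n) (nat_of_bool (eps < gm (x t.+1)))%:R <=
    merit l Gf sigma f g (x 0%N) + n%:R * e.
  elim: n => [_|n IH nT]; first by rewrite big_ord0 mulr0 mul0r.
  have := bad_step_decrease (Bx n) (Bx n.+1) eps0 ee (cert n nT).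
  by have := IH (ltnW nT); rewrite big_ord_recr /= [_ * (_ + _)]mulrDr -[n.+1%:R]natr1 [(_ + 1) * e]mulrDl mul1r; lra.
have lam := lambda0_gt0 cp.
have m0 : merit l Gf sigma f g (x 0%N) = f (x 0%N).
  by rewrite /merit (max_r Cx0) mulr0 addr0.
have mT : f (x 0%N) - Delta <= merit l Gf sigma f g (x T).
  apply: le_trans (fmin _ (Bx T)) _; rewrite lerDl mulr_ge0 ?(ltW lam)//.
  by rewrite le_max lexx orbT.
have compl : \sum_(t < T) (nat_of_bool (gm (x t.+1) <= eps))%:R =
    T%:R - \sum_(t < T) (nat_of_bool (eps < gm (x t.+1)))%:R :> R.
  apply/eqP; rewrite eq_sym subr_eq -big_split /=; apply/eqP.
  rewrite (eq_bigr (fun=> 1)) ?sumr_const ?card_ord// => t _.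
  by case: leP => _ /=; rewrite ?addr0 ?add0r.
have := telescope T (leqnn T); rewrite compl m0.
move: (\sum_(t < T) _) => N tel.
have e2 : 0 < eps ^+ 2 by rewrite exprn_gt0.
set b := eps ^+ 2 / (10 * l) in tel.
have l10 : 0 < 10 * l by have := l0; lra.
have b0 : 0 < b by rewrite divr_gt0.
have be : eps ^+ 2 = 10 * l * b by rewrite mulrC divfK// gt_eqF.
have eb : e <= b / 400.
  by apply: le_trans ee _; rewrite le_eqVlt /b; apply/orP; left; apply/eqP; field; rewrite gt_eqF.
have Db : Delta * 100 <= T%:R * b.
  rewrite -(ler_pM2l l10); move: TD; rewrite ler_pdivrMr// be; lra.
have Te : T%:R * e <= T%:R * (b / 400) by rewrite ler_wpM2l.
have NT : b * (N * 400) <= b * (T%:R * 5) by lra.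
rewrite ler_pM2l// in NT.
by have : 0 <= T%:R :> R by []; lra.
Qed.

Let UC y : U (nearest C y).
Proof.
apply: (cp_sub cp); apply: (cp_ball cp).
exact: nearest_in (cp_closed cp) (cp_ball cp) (cp_nonempty cp) y.
Qed.

(** Continuity makes stationarity of an iterate an event of the history. *)
Lemma grad_mapping_nearest_continuous : continuous (fun y : V => gm y).
Proof.
move=> y; apply: (@lip_continuous _ _ _ (3 * l)) => z.
apply: le_trans (grad_mapping_lip cp (UC z) (UC y)) _.
rewrite ler_pM2l ?mulr_gt0//.
exact: nearest_lip (cp_closed cp) (cp_ball cp) (cp_nonempty cp) (convex_feasible cp) z y.
Qed.

End OuterLoop.

Section Output.
Context {R : realType} {d : nat} {dO dX : measure_display}.
Context {Omega : measurableType dO} {Xi : measurableType dX}.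
Local Notation V := 'rV[R]_d.
Local Notation borelV := (g_sigma_algebraType (@open V)).
Local Notation B := (unit_ball : set V).
Variables (l Gf Gg sigma Delta eps : R) (f g : V -> R) (U : set V) (v : V -> V) (x0 : V).
Hypothesis cp : constrained_problem l Gf Gg sigma f g U.
Hypothesis vsub : forall x, unit_ball x -> limiting_subdiff f x (v x).
Hypothesis x0C : g x0 <= 0.
Hypothesis fmin : forall z, B z -> f x0 - Delta <= f z.
Hypothesis eps0 : 0 < eps.
Variables (K T : nat).
Hypothesis K0 : (0 < K)%N.
Hypothesis T0 : (0 < T)%N.
Hypothesis T_ge : 1000 * l * Delta / eps ^+ 2 <= T%:R.
Local Notation delta := ((6 * T%:R)^-1 : R).
Hypothesis e_le : e_ K l Gf Gg sigma delta <= eps ^+ 2 / (4000 * l).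
Variables (P : probability Omega R) (xi : nat -> Omega -> Xi) (vt : V -> Xi -> V).
Hypothesis oracle : stochastic_oracle P xi B v Gf vt.
Variables (J : Omega -> nat).
Hypothesis J_uniform : uniform_index P xi (iota 1 T) J.

Local Notation p := (softplus (lambda0 l Gf sigma) K%:R^-1).
Local Notation C := [set x : V | g x <= 0].
Local Notation gm y := (grad_mapping C f l (nearest C y)).
Local Notation H := (history xi).

Definition iterate t w := outer_iterate l g p K (fun n z => vt z (xi n w)) x0 t.

Let mxi k : measurable_fun setT (xi k). Proof. by case: oracle. Qed.
Let H_sub k : H k `<=` measurable. Proof. exact: history_measurable. Qed.

Let iterateS t : iterate t.+1 = run_output l Gf sigma g K xi vt (t * K) (iterate t).
Proof. by []. Qed.

Lemma iterate_ball t w : B (iterate t w).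
Proof.
elim: t w => [|t IH] w; first exact: (cp_ball cp).
by rewrite iterateS; exact: run_output_ball.
Qed.

Lemma iterate_adapted t : vadapted xi (t * K) (iterate t).
Proof.
elim: t => [|t IH]; first exact: measurable_cst.
rewrite iterateS mulSnr; apply: (run_output_adapted cp K0 oracle IH).
exact: iterate_ball.
Qed.

Local Notation run_good t := (good_run l Gf Gg sigma f g v K xi vt (t * K) (iterate t) delta).
Definition all_good : set Omega := \bigcap_(t in [set: 'I_T]) run_good t.

Let delta_gt0 : 0 < delta. Proof. by rewrite invr_gt0 mulr_gt0// ltr0n. Qed.

Let run_good_history t : (t < T)%N -> H (T * K) (run_good t).
Proof.
move=> tT; have le : (t * K + K <= T * K)%N by rewrite -mulSnr leq_mul2r tT orbT.
apply: (@history_le _ _ _ _ xi _ _ le).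
by apply: (good_run_history cp K0 oracle (@iterate_adapted t)); exact: iterate_ball.
Qed.

Let algebra := g_sigma_algebraType (H (T * K)).
Let measurable_history (A : set Omega) : H (T * K) A <-> @measurable _ algebra A.
Proof. by rewrite -[H (T * K) A]/(_ A) -{1}history_sigma. Qed.

Lemma all_good_history : H (T * K) all_good.
Proof.
apply/measurable_history; apply: (@fin_bigcap_measurable _ algebra); first exact: finite_finset.
by move=> t _; apply/measurable_history; exact: run_good_history.
Qed.

(** Union bound over the outer rounds. *)
Lemma all_good_prob : ((5 / 6)%:E <= P all_good)%E.
Proof.
have mA : measurable all_good by exact: H_sub all_good_history.
have mG (t : 'I_T) : measurable (run_good t) by exact: H_sub (run_good_history (ltn_ord t)).
have bound : (P (~` all_good) <= (1 / 6)%:E)%E.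
  have -> : ~` all_good = \big[setU/set0]_(t < T) ~` run_good t.
    by rewrite /all_good setC_bigcap -bigcup_seq; congr bigcup;
      apply/seteqP; split => t //= _; rewrite mem_index_enum.
  apply: le_trans (@Boole_inequality _ _ _ P (fun t => ~` run_good t) T _) _.
    by move=> t tT; apply: measurableC; exact: (mG (Ordinal tT)).
  apply: (@le_trans _ _ (\sum_(t < T) delta%:E)%E).
    apply: lee_sum => t _; apply: (good_run_prob cp vsub K0 oracle) => //.
      exact: iterate_adapted.
    by move=> w; exact: iterate_ball.
  rewrite sumEFin sumr_const card_ord lee_fin -mulr_natl le_eqVlt; apply/orP; left.
  by apply/eqP; field; rewrite gt_eqF// ltr0n.
have := probability_setC P mA; move: bound.
rewrite -[P all_good]fineK ?fin_num_measure// => bound E.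
move: bound; rewrite E -EFinB !lee_fin; lra.
Qed.

Let stationary t : set Omega := [set w | gm (iterate t.+1 w) <= eps].

Let stationary_history t : (t < T)%N -> H (T * K) (stationary t).
Proof.
move=> tT; have le : (t.+1 * K <= T * K)%N by rewrite leq_mul2r tT orbT.
apply: (@history_le _ _ _ _ xi _ _ le); rewrite -history_sigma.
have := measurableT_comp (continuous_measurable_real (grad_mapping_nearest_continuous cp))
  (@iterate_adapted t.+1).
move=> mh; have := mh measurableT `]-oo, eps]%classic (measurable_itv _).
by rewrite setTI; congr (<<s _ >> _); apply/seteqP; split=> w /=; rewrite in_itv.
Qed.

Lemma all_good_stationary w : all_good w ->
  4 / 5 * T%:R <= \sum_(t < T) \1_(stationary t) w :> R.
Proof.
move=> Gw.
have := @most_iterates_stationary _ _ _ _ _ _ _ _ _ cp (fun t => iterate t w) T Delta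
  (e_ K l Gf Gg sigma delta) eps eps0 e_le T_ge x0C (fun t => iterate_ball t w) fmin.
move=> /(_ _)/le_trans-> //.
  move=> t tT; have := Gw (Ordinal tT) I => /= Gt.
  have := good_run_certificate cp vsub K0 _ Gt; rewrite iterateS; apply.
  by move=> w'; exact: iterate_ball.
by apply: ler_sum => t _; rewrite indicE mem_setE.
Qed.

Let pr (A : set Omega) : R := fine (P A).
Let prE A : measurable A -> P A = (pr A)%:E.
Proof. by move=> mA; rewrite /pr fineK// fin_num_measure. Qed.

Let integral_indicator A : measurable A -> \int[P]_w (\1_A w : R) = pr A.
Proof. by move=> mA; rewrite /Rintegral integral_indic// setIT. Qed.

Let hit t : set Omega := J @^-1` [set t.+1] `&` (all_good `&` stationary t).

Let m_event t : (t < T)%N -> H (T * K) (all_good `&` stationary t).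
Proof.
move=> tT; apply/measurable_history; apply: (@measurableI _ algebra);
  apply/measurable_history; [exact: all_good_history|exact: stationary_history].
Qed.

Let m_index j : measurable (J @^-1` [set j]).
Proof. by have [mJ _ _] := J_uniform; rewrite -[_ @^-1` _]setTI; exact: mJ. Qed.

Let hit_prob t : (t < T)%N -> pr (hit t) = T%:R^-1 * pr (all_good `&` stationary t).
Proof.
move=> tT; have [_ Juni Jind] := J_uniform; rewrite /pr.
have -> : P (hit t) = (P (J @^-1` [set t.+1]) * P (all_good `&` stationary t))%E.
  exact: Jind (m_event tT).
have tI : t.+1 \in iota 1 T by rewrite mem_iota /= add1n ltnS.
rewrite Juni tI size_iota.
by rewrite [P (_ `&` _)]prE ?div1r//; exact: H_sub (m_event tT).
Qed.

(** Averaging over the independent index: given the oracle's samples, the index hits a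
stationary iterate with probability at least 4/5 on the good event. *)
Lemma stationary_output_prob (S : set Omega) : measurable S ->
  (forall t w, (t < T)%N -> J w = t.+1 -> stationary t w -> S w) ->
  ((2 / 3)%:E <= P S)%E.
Proof.
move=> mS hitS; rewrite prE// lee_fin.
have mhit (t : 'I_T) : measurable (hit t).
  by apply: measurableI; [exact: m_index|exact: H_sub (m_event (ltn_ord t))].
have mE (t : 'I_T) : measurable (all_good `&` stationary t) by exact: H_sub (m_event (ltn_ord t)).
have mG : measurable all_good by exact: H_sub all_good_history.
have TR : 0 < T%:R :> R by rewrite ltr0n.
have [int_hit sum_hit] := Rintegral_sum (P := P) (index_enum 'I_T)
  (fun t => integrable_indic P (mhit t)).
have [int_E sum_E] := Rintegral_sum (P := P) (index_enum 'I_T)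
  (fun t => integrable_indic P (mE t)).
have le1 : \sum_(t < T) pr (hit t) <= pr S.
  rewrite -(eq_bigr _ (fun t _ => integral_indicator (mhit t))) -sum_hit.
  rewrite -integral_indicator//; apply: le_Rintegral => //; first exact: integrable_indic.
  move=> w _; have [/existsP[t0 /eqP Jt0]|/existsPn noJ] :=
    boolP [exists t : 'I_T, J w == t.+1]; last first.
    rewrite big1 ?indicE// => t _; rewrite indicE memNset// => -[/= Jt _].
    by have := noJ t; rewrite Jt eqxx.
  rewrite (bigD1 t0)//= big1 ?addr0 => [|t tt0]; last first.
    rewrite indicE memNset// => -[/= Jt _]; move: tt0; rewrite -(inj_eq val_inj) /=.
    by have /eqP := Jt0; rewrite Jt eqSS => ->.
  rewrite !indicE ler_nat; case: (boolP (w \in hit t0)) => //.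
  by rewrite inE => -[_ [_ st]]; rewrite mem_set//; exact: hitS st.
have le2 : 4 / 5 * T%:R * pr all_good <= \sum_(t < T) pr (all_good `&` stationary t).
  rewrite -(eq_bigr _ (fun t _ => integral_indicator (mE t))) -sum_E.
  rewrite -integral_indicator// -RintegralZl//; last exact: integrable_indic.
  apply: le_Rintegral => //; first exact: (integrableZl _ (4 / 5 * T%:R) (integrable_indic P mG)).
  move=> w _; rewrite indicE; case: (boolP (w \in all_good)) => [|_]; last first.
    by rewrite mulr0 sumr_ge0// => t _; rewrite indicE.
  rewrite inE => Gw; rewrite mulr1; apply: le_trans (all_good_stationary Gw) _.
  by apply: ler_sum => t _; rewrite indicI/= [\1_all_good w]indicE mem_set// mul1r.
have le3 : 5 / 6 <= pr all_good.
  by rewrite -lee_fin -prE//; exact: all_good_prob.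
have E : \sum_(t < T) pr (hit t) = T%:R^-1 * \sum_(t < T) pr (all_good `&` stationary t).
  by rewrite mulr_sumr; apply: eq_bigr => t _; exact: hit_prob.
apply: le_trans le1; rewrite E ler_pdivlMl//; apply: le_trans le2.
by have := ler_wpM2l (ltW TR) le3; lra.
Qed.

(** An index above T has probability zero but may occur; 0 is then the default entry
of the list of iterates. *)
Definition selected j w : V := if (j <= T)%N then iterate j w else 0.

Lemma selected_measurable j : measurable [set w | gm (selected j w) <= eps].
Proof.
have mY : measurable_fun [set: Omega] (selected j : Omega -> borelV).
  have [jT|jT] := boolP (j <= T)%N; last first.
    have -> : selected j = cst 0 by apply/funext => w; rewrite /selected (negPf jT).
    exact: measurable_cst.
  have -> : selected j = iterate j by apply/funext => w; rewrite /selected jT.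
  apply: measurable_vector => i; apply: (adapted_measurable (@H_sub (j * K))).
  by apply: measurable_coord; exact: iterate_adapted.
have mh := measurableT_comp (continuous_measurable_real (grad_mapping_nearest_continuous cp)) mY.
have := mh measurableT `]-oo, eps]%classic (measurable_itv _).
by rewrite setTI; congr measurable; apply/seteqP; split=> w /=; rewrite in_itv.
Qed.

(** The set [C] being convex, the one projection returns the nearest point of the
selected iterate, to which the probability bound applies. *)
Lemma output_guarantee (xhat : Omega -> V) (calls projections : Omega -> nat) :
  (forall w, exec (fun n z => vt z (xi n w)) C
     (penalized_psm g p (2 * l) l T K x0 (J w)) 0 0 (xhat w, calls w, projections w)) ->
  [/\ forall w, C (xhat w),
      measurable [set w | grad_mapping C f l (xhat w) <= eps],
      ((2 / 3)%:E <= P [set w | (grad_mapping C f l (xhat w) <= eps)%R])%E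
    & forall w, calls w = (T * K)%N /\ projections w = 1%N].
Proof.
move=> run; have xhatP w : [/\ projset C (selected (J w) w) (xhat w),
    calls w = (T * K)%N & projections w = 1%N].
  have /exec_penalized_psm[px -> ->] := run w; split=> //; move: px.
  rewrite /selected; case: leqP => [JT|TJ]; last by rewrite nth_default// size_map size_iota.
  by rewrite (nth_map 0%N) ?size_iota// nth_iota.
have xhatE w : xhat w = nearest C (selected (J w) w).
  apply: (projset_nearest (cp_closed cp) (cp_ball cp) (cp_nonempty cp) (convex_feasible cp)).
  by have [] := xhatP w.
have mS : measurable [set w | grad_mapping C f l (xhat w) <= eps].
  have -> : [set w | grad_mapping C f l (xhat w) <= eps] =
      \bigcup_j (J @^-1` [set j] `&` [set w | gm (selected j w) <= eps]).
    apply/seteqP; split=> [w /= |w [j _ [/= <-]]]; rewrite xhatE//.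
    by move=> gw; exists (J w).
  by apply: bigcup_measurable => j _; apply: measurableI; [exact: m_index|exact: selected_measurable].
split=> //.
- by move=> w; have [[]] := xhatP w.
- apply: (stationary_output_prob mS) => t w tT Jt.
  by rewrite /stationary /= xhatE Jt /selected tT.
- by move=> w; have [] := xhatP w.
Qed.

End Output.

(** * The sizes of T and K *)

Section Complexity.
Context {R : realType}.
Implicit Types (l Gf Gg sigma Delta eps : R).

Lemma horizon_gt0 l Delta eps : (0 < horizon l Delta eps)%N.
Proof. by rewrite /horizon leq_max. Qed.

Lemma natr_ceil (X : R) : 0 <= X -> `|Num.ceil X|%N%:R = (Num.ceil X)%:~R :> R.
Proof.
move=> X0; rewrite natr_absz ger0_norm// ceil_ge0.
by apply: lt_le_trans X0; rewrite ltrN10.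
Qed.

Lemma scaled_gap_ge0 n l Delta eps : 0 < l -> 0 <= Delta ->
  0 <= n%:R * l * Delta / eps ^+ 2.
Proof.
move=> l0 D0.
exact: divr_ge0 (mulr_ge0 (mulr_ge0 (ler0n _ _) (ltW l0)) D0) (sqr_ge0 _).
Qed.

Lemma horizon_ge l Delta eps : 0 < l -> 0 <= Delta ->
  1000 * l * Delta / eps ^+ 2 <= (horizon l Delta eps)%:R.
Proof.
move=> l0 D0; have := scaled_gap_ge0 1000 eps l0 D0.
rewrite /horizon; move: (1000%:R * l * Delta / eps ^+ 2) => X X0.
apply: le_trans (ceil_ge X) _.
by rewrite -natr_ceil// ler_nat leq_maxr.
Qed.

Lemma horizon_le l Delta eps : 0 < l -> 0 <= Delta ->
  (horizon l Delta eps)%:R <= 1000 * (1 + l * Delta / eps ^+ 2).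
Proof.
move=> l0 D0; have := scaled_gap_ge0 1000 eps l0 D0; rewrite /horizon.
have -> : 1000 * (1 + l * Delta / eps ^+ 2) = 1000 + 1000 * l * Delta / eps ^+ 2.
  by rewrite mulrDr mulr1 !mulrA.
move: (1000%:R * l * Delta / eps ^+ 2) => X X0.
have cX : `|Num.ceil X|%N%:R <= X + 1.
  by rewrite natr_ceil// -lerBlDr ltW// -[1]/(1%:~R) -intrB ceilB1_lt.
apply: (@le_trans _ _ (3 + X)); last by rewrite lerD2r ler_nat.
apply: (@le_trans _ _ (2 + `|Num.ceil X|%N%:R)); last by lra.
by rewrite -natrD ler_nat geq_max leq_addr leq_addl.
Qed.

Lemma ler_lnW (u w : R) : 0 < u -> u <= w -> ln u <= ln w.
Proof. by move=> u0 uw; rewrite ler_ln// posrE; exact: lt_le_trans uw. Qed.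

Lemma ln_leB1 (u : R) : 0 < u -> ln u <= u - 1.
Proof.
move=> u0; have E : u = 1 + (u - 1) by rewrite addrC subrK.
by rewrite [in leLHS]E le_ln1Dx// ltrBrDr addNr.
Qed.

(** The tangent to the logarithm at M: a logarithm can be absorbed by an
    arbitrarily small multiple of its argument. *)
Lemma ln_le_affine (M y : R) : 0 < M -> 0 < y -> ln y <= y / M + ln M.
Proof.
move=> M0 y0; have yM : 0 < y / M by rewrite divr_gt0.
rewrite -lerBlDr -ln_div ?posrE//.
by apply: le_trans (ln_leB1 yM) _; rewrite lerBlDr lerDl.
Qed.

Lemma affine_dominates_ln (a b c : R) : 0 < b -> 0 < c ->
  exists2 A, 0 <= A & a + b * ln (A + 3) <= c * A.
Proof.
move=> b0 c0; set M := 2 * b / c.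
have M0 : 0 < M by rewrite divr_gt0// mulr_gt0.
have s0 : 0 <= `|a| + 3 * c / 2 + b * `|ln M|.
  by rewrite !addr_ge0// mulr_ge0// ?ltW// mulr_gt0.
exists (2 * (`|a| + 3 * c / 2 + b * `|ln M|) / c).
  by rewrite divr_ge0 ?(ltW c0)// mulr_ge0.
set A := 2 * _ / c.
have A0 : 0 <= A by rewrite divr_ge0 ?(ltW c0)// mulr_ge0.
have cA : c * A = 2 * (`|a| + 3 * c / 2 + b * `|ln M|).
  by rewrite /A mulrC divfK// gt_eqF.
have L : b * ln (A + 3) <= c / 2 * (A + 3) + b * ln M.
  have A3 : 0 < A + 3 by rewrite ltr_wpDl.
  have := ler_wpM2l (ltW b0) (ln_le_affine M0 A3).
  have -> : b * ((A + 3) / M + ln M) = c / 2 * (A + 3) + b * ln M; last by [].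
  by rewrite /M; field; rewrite !gt_eqF.
have bM : b * ln M <= b * `|ln M| by rewrite ler_wpM2l ?(ltW b0)// ler_norm.
have := ler_norm a; lra.
Qed.

Lemma e_star_ge l Gf : 0 < l -> 0 < Gf ->
  exists2 c, 0 < c & forall eps, 0 < eps <= 1 -> c * eps ^+ 2 <= e_star l Gf eps.
Proof.
move=> l0 Gf0; have GF0 : 0 < GF l Gf by rewrite /GF; lra.
have c1 : 0 < (4000 * l)^-1 by rewrite invr_gt0; exact: mulr_gt0 (ltr0Sn _ _) l0.
have c2 : 0 < GF l Gf / (60 * l).
  by apply: divr_gt0 => //; exact: mulr_gt0 (ltr0Sn _ _) l0.
rewrite /e_star; move: (4000 * l)^-1 c1 => u u0.
exists (Num.min u (GF l Gf / (60 * l))); first by rewrite lt_min u0.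
move=> eps /andP[e0 e1]; rewrite le_min; apply/andP; split.
  by rewrite mulrC ler_wpM2l ?sqr_ge0// ge_min lexx.
apply: (@le_trans _ _ (GF l Gf / (60 * l) * eps ^+ 2)).
  by rewrite ler_wpM2r ?sqr_ge0// ge_min lexx orbT.
have -> : GF l Gf * eps / (60 * l) = GF l Gf / (60 * l) * eps by rewrite mulrAC.
by rewrite ler_wpM2l ?(ltW c2)// expr2 ler_piMr// ltW.
Qed.

Lemma horizon_le_powerN l Delta : 0 < l -> 0 <= Delta ->
  exists2 D, 1 <= D & forall eps, 0 < eps <= 1 ->
    (horizon l Delta eps)%:R <= D * eps ^- 2.
Proof.
move=> l0 D0; exists (1000 * (1 + l * Delta)).
  rewrite -[leLHS]mulr1; apply: ler_pM => //; first by rewrite ler1n.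
  by rewrite lerDl mulr_ge0// ltW.
move=> eps /andP[e0 e1]; apply: le_trans (horizon_le eps l0 D0) _.
rewrite -[leRHS]mulrA ler_wpM2l ?ler0n// mulrDl mul1r lerD2r.
by rewrite invf_ge1 ?exprn_gt0// exprn_ile1// ltW.
Qed.

(** K is chosen just above A times 1/eps^2 times 1 + log (1/eps).  Since log K and
    log T are at most a constant plus a constant times 1 + log (1/eps), the
    requirement on K becomes one on A alone, in which the two sides grow like
    log A and A. *)
Lemma admissible_K_exists l Gf Gg sigma Delta :
  0 < l -> 0 < Gf -> 0 < Gg -> 0 < sigma -> 0 <= Delta ->
  exists Kf : R -> nat,
    [/\ forall eps, 0 < eps <= 1 -> admissible_K l Gf Gg sigma Delta eps (Kf eps),
        soft_O (fun eps => (Kf eps)%:R) 2 &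
        soft_O (fun eps => (horizon l Delta eps * Kf eps)%N%:R) 4].
Proof.
move=> l0 Gf0 Gg0 s0 D0.
have [c1 c10 c1P] := e_star_ge l0 Gf0.
have [D D1 DP] := horizon_le_powerN l0 D0.
have G0 : 0 < GH l Gf Gg sigma.
  rewrite /GH /GF /lambda0; apply: addr_gt0; first by lra.
  by rewrite mulr_gt0// divr_gt0//; lra.
set B := GH l Gf Gg sigma ^+ 2 / l.
have B0 : 0 < B by rewrite /B divr_gt0// exprn_gt0.
(* [ln (K + 1) <= ln (A + 3) + 3 L] and [ln (6 T) <= ln (6 D) + 2 L] for [L = Lg eps],
   whence [7 * B = (3 + 2 * 2) * B] *)
set a := l + ln 2 + 2 * B * ln (6 * D) + 7 * B.
have [A A0 AP] := affine_dominates_ln a B0 c10.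
pose Lg eps : R := 1 + ln eps^-1.
exists (fun eps => (Num.truncn (A * eps ^- 2 * Lg eps)).+2).
have facts eps : 0 < eps <= 1 -> [/\ 1 <= eps ^- 2, 1 <= Lg eps,
    A * eps ^- 2 * Lg eps <= (Num.truncn (A * eps ^- 2 * Lg eps)).+2%:R &
    (Num.truncn (A * eps ^- 2 * Lg eps)).+2%:R <= A * eps ^- 2 * Lg eps + 2].
  move=> /andP[e0 e1].
  have i1 : 1 <= eps ^- 2 by rewrite invf_ge1 ?exprn_gt0// exprn_ile1// ltW.
  have L1 : 1 <= Lg eps by rewrite lerDl ln_ge0// invf_ge1.
  have X0 : 0 <= A * eps ^- 2 * Lg eps.
    by rewrite !mulr_ge0// (le_trans ler01).
  have [t1 t2] : (Num.truncn (A * eps ^- 2 * Lg eps))%:R <= A * eps ^- 2 * Lg eps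
      /\ A * eps ^- 2 * Lg eps < (Num.truncn (A * eps ^- 2 * Lg eps)).+1%:R.
    by have /andP := truncn_itv X0.
  split=> //; first by apply: le_trans (ltW t2) _; rewrite ler_nat.
  by rewrite -addn2 natrD lerD2r.
have K_le eps : 0 < eps <= 1 ->
    (Num.truncn (A * eps ^- 2 * Lg eps)).+2%:R <= (A + 2) * eps ^- 2 * Lg eps.
  move=> /facts[i1 L1 _ /le_trans]; apply.
  rewrite -!mulrA mulrDl lerD2l; have := ler_pM ler01 ler01 i1 L1; lra.
split.
- move=> eps e01; split=> //; apply: le_trans (c1P _ e01).
  have [i1 L1 Kge Kle] := facts _ e01; have TD := DP _ e01.
  have := horizon_gt0 l Delta eps; rewrite -(ltr0n R).
  move: (horizon _ _ _)%:R TD => T TD T0.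
  move: (Num.truncn _) Kge Kle => k Kge Kle.
  have [e0 _] := andP e01.
  have L0 : 0 < Lg eps := lt_le_trans ltr01 L1.
  have i0 : 0 < eps ^- 2 := lt_le_trans ltr01 i1.
  have li : ln (eps ^- 2) <= 2 * Lg eps - 2.
    by rewrite -exprVn lnXn ?invr_gt0// -mulr_natl /Lg; lra.
  have lL : ln (Lg eps) <= Lg eps - 1 := ln_leB1 L0.
  have A3 : 1 <= A + 3 by lra.
  have lA : 0 <= ln (A + 3) by rewrite ln_ge0.
  have l6 : 0 <= ln (6 * D) by rewrite ln_ge0//; lra.
  have lK : ln k.+3%:R <= ln (A + 3) + 3 * Lg eps.
    have : k.+3%:R <= (A + 3) * (eps ^- 2 * Lg eps).
      rewrite -addn1 natrD; have := ler_pM ler01 ler01 i1 L1; lra.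
    have A3' : 0 < A + 3 by lra.
    have iL : 0 < eps ^- 2 * Lg eps by rewrite mulr_gt0.
    by move=> /(ler_lnW (ltr0Sn _ _)); rewrite (lnM A3' iL) (lnM i0 L0); lra.
  have lT : ln (6 * T) <= ln (6 * D) + 2 * Lg eps.
    have : 6 * T <= (6 * D) * eps ^- 2 by lra.
    have D6 : 0 < 6 * D by lra.
    by move=> /(ler_lnW (mulr_gt0 (ltr0Sn _ _) T0)); rewrite (lnM D6 i0); lra.
  have ln20 : 0 <= ln (2 : R) by rewrite ln_ge0//; lra.
  have k0 : 0 < k.+2%:R :> R by rewrite ltr0n.
  rewrite /e_ /U_ invrK -mulrDl ler_pdivrMr// -/B.
  apply: (@le_trans _ _ (Lg eps * (a + B * ln (A + 3)))); last first.
    apply: (@le_trans _ _ (Lg eps * (c1 * A))); first by rewrite ler_wpM2l// ltW.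
    have -> : Lg eps * (c1 * A) = c1 * eps ^+ 2 * (A * eps ^- 2 * Lg eps).
      by field; rewrite gt_eqF.
    by rewrite ler_wpM2l// mulr_ge0 ?sqr_ge0// ltW.
  have h1 := ler_wpM2l (ltW B0) lK.
  have h2 := ler_wpM2l (ltW B0) lT.
  have h3 : 0 <= (Lg eps - 1) * (l + ln 2 + 2 * (B * ln (6 * D)) + B * ln (A + 3)).
    have h4 := mulr_ge0 (ltW B0) l6; have h5 := mulr_ge0 (ltW B0) lA.
    by apply: mulr_ge0; lra.
  rewrite /a; lra.
- by exists (A + 2), 1%N => eps /K_le; rewrite expr1.
- exists (D * (A + 2)), 1%N => eps e01; rewrite expr1 natrM.
  have -> : D * (A + 2) * eps ^- 4 * (1 + ln eps^-1) =
      D * eps ^- 2 * ((A + 2) * eps ^- 2 * Lg eps).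
    by rewrite /Lg; field; rewrite gt_eqF//; case/andP: e01.
  by apply: ler_pM => //; [exact: DP|exact: K_le].
Qed.

End Complexity.

Theorem theorem1 (R : realType) :
  exists2 c : R, 0 < c &
  forall l Gf Gg sigma Delta : R,
  0 < l -> 0 < Gf -> 0 < Gg -> 0 < sigma -> 0 <= Delta ->
  [/\ (* T = O(1 + l Delta / eps^2), with an absolute constant *)
      forall eps : R, 0 < eps <= 1 ->
        (horizon l Delta eps)%:R <= c * (1 + l * Delta / eps ^+ 2),
      (* an admissible K = O~(eps^-2) exists, and then T K = O~(eps^-4) *)
      exists Kf : R -> nat,
        [/\ forall eps : R, 0 < eps <= 1 ->
              admissible_K l Gf Gg sigma Delta eps (Kf eps),
            soft_O (fun eps => (Kf eps)%:R) 2 &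
            soft_O (fun eps => (horizon l Delta eps * Kf eps)%N%:R) 4]
    & forall (d : nat) (f g : 'rV[R]_d -> R) (U : set 'rV[R]_d)
        (x0 : 'rV[R]_d) (v : 'rV[R]_d -> 'rV[R]_d),
      let B : set 'rV[R]_d := unit_ball in
      let C : set 'rV[R]_d := [set x | g x <= 0] in
      (* (i) *)
      closed C -> C `<=` B -> C x0 ->
      (* (ii) *)
      open U -> convex_set U -> B `<=` U ->
      weakly_convex U l f ->
      (forall x y, U x -> U y -> `|f x - f y| <= Gf * enorm (x - y)) ->
      (forall x, B x -> limiting_subdiff f x (v x)) ->
      (* (iii) *)
      convex_function U g ->
      (forall x, U x -> differentiable g x) ->
      (forall x, U x -> {for x, continuous (gradient g)}) ->
      (forall x, B x -> enorm (gradient g x) <= Gg) ->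
      (forall z, B z -> g z = 0 -> sigma <= enorm (gradient g z)) ->
      (* (iv) *)
      (forall x, U x -> differentiable f x) ->
      (forall x y, U x -> U y ->
         enorm (gradient f x - gradient f y) <= l * enorm (x - y)) ->
      Delta = f x0 - min_on B f ->
      forall (eps : R) (K : nat), 0 < eps <= 1 ->
      admissible_K l Gf Gg sigma Delta eps K ->
      let T := horizon l Delta eps in
      let p := softplus (lambda0 l Gf sigma) (K%:R^-1) in
      let beta := 2 * l in
      let m := l in
      (* the strong convexity required of the subproblems H_t holds *)
      (forall x, B x -> strongly_convex B m (subproblem f g p beta x)) /\
      forall (dO dX : measure_display) (Omega : measurableType dO)
        (Xi : measurableType dX) (P : probability Omega R)
        (xi : nat -> Omega -> Xi) (vt : 'rV[R]_d -> Xi -> 'rV[R]_d)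
        (J : Omega -> nat) (xhat : Omega -> 'rV[R]_d)
        (calls projections : Omega -> nat),
      stochastic_oracle P xi B v Gf vt ->
      uniform_index P xi (iota 1 T) J ->
      (forall w, exec (fun n z => vt z (xi n w)) C
                   (penalized_psm g p beta m T K x0 (J w)) 0 0
                   (xhat w, calls w, projections w)) ->
      [/\ forall w, C (xhat w),
          measurable [set w | grad_mapping C f l (xhat w) <= eps],
          ((2 / 3)%:E <= P [set w | (grad_mapping C f l (xhat w) <= eps)%R])%E
        & forall w, calls w = (T * K)%N /\ projections w = 1%N]].
Proof.
exists 1000; first exact: ltr0Sn.
move=> l Gf Gg sigma Delta l0 Gf0 Gg0 sigma0 Delta0; split.
- by move=> eps _; exact: horizon_le.
- exact: admissible_K_exists.
move=> d f g U x0 v B C clC CB Cx0 oU cU BU wf lf vsub cg dg cgg Gub Glb df sf DE eps K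
  /andP[eps0 _] [K2 eK] T p beta m.
have cp : constrained_problem l Gf Gg sigma f g U.
  by apply: ConstrainedProblem => //; exists x0.
have K0 : (0 < K)%N by apply: leq_trans K2.
have p_mono (s t : R) : s <= t -> p s <= p t.
  by apply: softplus_mono; [exact: lambda0_gt0 cp|rewrite invr_gt0 ltr0n].
have p_convex (s t a : R) : 0 <= a <= 1 -> p (a * s + (1 - a) * t) <= a * p s + (1 - a) * p t.
  by apply: softplus_convex; rewrite invr_gt0 ltr0n.
split=> [x _|dO dX Omega Xi P xi vt J xhat calls projections oracle J_uniform run].
  exact: (@strongly_convexW _ _ _ _ _ _ BU (@subproblem_strongly_convex _ _ _ _ _ _ _ _ _ cp _ x p_mono p_convex)).
have min_f z : B z -> f x0 - Delta <= f z.
  have [_ min_f] : argmin B f (xget 0 (argmin B f)).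
    apply: xget_argmin; apply: (@argmin_nonempty _ _ _ _ Gf) => //.
    - exact: closed_unit_ball.
    - by exists x0; exact: CB.
    - by move=> x y Bx By; apply: lf; exact: BU.
  by move=> /min_f; rewrite DE /min_on; lra.
have e_le : e_ K l Gf Gg sigma (6 * T%:R)^-1 <= eps ^+ 2 / (4000 * l).
  by apply: le_trans eK _; rewrite ge_min lexx.
exact: (output_guarantee cp vsub Cx0 min_f eps0 K0 (horizon_gt0 l Delta eps)
  (horizon_ge eps l0 Delta0) e_le oracle J_uniform run).
Qed.
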